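(* Let $G$ be a finite group with abelian normal Sylow $2$-subgroup. The group $G$ is fully realizable if and only if $G = W \times (H \rtimes \mathbf{C}_3)$, where $W$ is a subgroup of $\mathbf{C}_4$ and $H$ is a finite elementary abelian $2$-group.
   Context: Rings are associative with identity and ring homomorphisms preserve the identity. $R^\times$ is the group of units of a ring $R$; a ring endomorphism $\psi$ of $R$ restricts to a group endomorphism $\psi^\times$ of $R^\times$. A group $G$ is fully realizable if there is a ring $R$ with $R^\times = G$ (up to isomorphism) such that every group endomorphism of $G$ is of the form $\psi^\times$ for some ring endomorphism $\psi$ of $R$. $\mathbf{C}_m$ denotes the cyclic group of order $m$. Equality of groups means isomorphism, and $H \rtimes \mathbf{C}_3$ stands for an arbitrary semidirect product, determined by any (possibly trivial) homomorphism $\mathbf{C}_3 \to \mathrm{Aut}(H)$.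
   Formalization: The formal statement adds the alternative G = W × H (no C_3 factor), since as printed the equivalence fails for 2-groups: the trivial group, the units of F_2, is fully realizable but W × (H ⋊ C_3) has order divisible by 3; for groups that are not 2-groups it is the printed statement. *)

(* Defs.v *)
From HB Require Import structures.
From mathcomp Require Import all_boot all_order all_fingroup all_algebra.
From mathcomp Require Import all_solvable.

Set Implicit Arguments.
Unset Strict Implicit.
Unset Printing Implicit Defensive.

Import GRing.Theory.

(* [unitRingType] would force the ring to be nontrivial and come with a boolean
   unit predicate; units are therefore two-sided invertible elements of an
   arbitrary (possibly zero, possibly infinite) [pzRingType]. *)
Definition invertible (R : pzRingType) (u : R) : Prop :=
  exists v : R, (u * v = 1 /\ v * u = 1)%R.

(* [iota] restricts to a group isomorphism from [G] onto the units of [R]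
   (its values outside [G] are irrelevant). *)
Definition units_isom (gT : finGroupType) (G : {group gT}) (R : pzRingType)
    (iota : gT -> R) : Prop :=
  [/\ {in G &, forall x y, iota (x * y)%g = (iota x * iota y)%R},
      {in G &, injective iota}
    & forall u : R, invertible u <-> exists2 x, x \in G & iota x = u].

(* [iota] transports [psi] restricted to the units of [R] to the
   endomorphism [phi] of [G]. *)
Definition fully_realizable (gT : finGroupType) (G : {group gT}) : Prop :=
  exists (R : pzRingType) (iota : gT -> R), units_isom G iota /\
    forall phi : {morphism G >-> gT}, (phi @* G)%g \subset G ->
      exists psi : {rmorphism R -> R},
        {in G, forall x, psi (iota x) = iota (phi x)}.

(* Main.v *)
From HB Require Import structures.
Require Import Defs.
From mathcomp Require Import all_boot all_order all_fingroup all_algebra.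
From mathcomp Require Import all_solvable all_field.

(* Necessity.  Extending the trivial endomorphism gives 2 = 0 in R.  Write
   G = P ><| C.  The fixed ring of the extension of the retraction G -> C is
   reduced with unit group C, so the span of C is commutative (Wedderburn).  For
   x in C and e = sum_i x^i, the unit 1 + x + e is inverted by the extension of
   c |-> c^-1, which forces x^3 = 1.  If C = <a> x D and b in D, the two
   projections of C show (1 + a)(1 + b) = 0; replacing a by ab gives b^2 = 1, so
   |C| <= 3.  For a in P - 1 one has (ca)a = a(ca) = (ac)a = a(ac), whence p^2 is
   centralised by C for p in P; so [P, C] is elementary abelian and
   G = Z x ([P, C] C) with Z = C_P(C).  Extending the cube map of Z gives z^4 = 1,
   and if w in Z has order 4 and G = <w> x D, then (w - 1)(b - 1) = 0 and
   (wb - 1)(b - 1) = 0 for b in D :&: Z, so b^2 = 1.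

   Sufficiency.  All nontrivial squares in P equal one involution z.  Turn P into
   an F_2-space N by x + y = xy z^(x^2 <> 1 and y^2 <> 1); then F_2[C] (+) N is a
   ring in which the elements (c, p) form a copy of G and span additively. *)

Set Implicit Arguments.
Unset Strict Implicit.
Unset Printing Implicit Defensive.

Import GRing.Theory.

(** * Finite reduced rings are commutative *)

Section FiniteRng.
Local Open Scope ring_scope.

Variable R : pzRingType.
Implicit Types (s : seq R) (a b r x y : R).

(* [1] need not belong to [s]: the induction below descends to ideals. *)
Definition sub_rng s :=
  {in s &, forall x y, x - y \in s} /\ {in s &, forall x y, x * y \in s}.

Lemma sub_rng0 s x : sub_rng s -> x \in s -> 0 \in s.
Proof. by case=> sB _ sx; rewrite -(subrr x) sB. Qed.

Lemma sub_rngN s x : sub_rng s -> x \in s -> - x \in s.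
Proof. by move=> ss sx; rewrite -sub0r (proj1 ss) // (sub_rng0 ss sx). Qed.

Lemma sub_rngD s x y : sub_rng s -> x \in s -> y \in s -> x + y \in s.
Proof. by move=> ss sx sy; rewrite -[y]opprK (proj1 ss) // sub_rngN. Qed.

(** Finiteness makes left multiplication by [x0] a bijection of [s]. The [e] with [x0 * e = x0] is a
    left identity because [x0] cancels on the left, and a right one because
    [(r * e - r) * x0 = 0]. *)
Lemma sub_rng_domain_unit s x0 :
    sub_rng s -> {in s &, forall x y, x * y = 0 -> x = 0 \/ y = 0} ->
    x0 \in s -> x0 != 0 ->
  exists2 e, e \in s & {in s, forall r, e * r = r /\ r * e = r}.
Proof.
move=> ss sdom sx0 nzx; have [sB sM] := ss.
have lreg : {in s &, forall a b, x0 * a = x0 * b -> a = b}.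
  move=> a b sa sb eqab; have /sdom[] // : x0 * (a - b) = 0.
  - by rewrite mulrBr eqab subrr.
  - by rewrite sB.
  - by move=> x00; rewrite x00 eqxx in nzx.
  by move/eqP; rewrite subr_eq0 => /eqP.
have Umap : uniq (map ( *%R x0) (undup s)).
  rewrite map_inj_in_uniq ?undup_uniq // => a b; rewrite !mem_undup.
  exact: lreg.
have Smap : {subset map ( *%R x0) (undup s) <= undup s}.
  by move=> y /mapP[a]; rewrite !mem_undup => sa ->; rewrite sM.
have [|_ Emap] := uniq_min_size Umap Smap; first by rewrite size_map.
have : x0 \in map ( *%R x0) (undup s) by rewrite Emap mem_undup.
case/mapP=> e; rewrite mem_undup => se x0e.
have eL r : r \in s -> e * r = r.
  by move=> sr; apply: lreg; rewrite ?sM // mulrA -x0e.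
exists e => // r sr; split; first exact: eL.
have /sdom[] // : (r * e - r) * x0 = 0.
- by rewrite mulrBl -mulrA eL // subrr.
- by rewrite sB ?sM.
- by move/eqP; rewrite subr_eq0 => /eqP.
by move=> x00; rewrite x00 eqxx in nzx.
Qed.

(** Wedderburn's little theorem, [finDomain_mulrC]. It speaks of ring types, so the finite type
    [seq_sub s] is made into a ring with identity [e], which need not be 1. *)
Lemma sub_rng_domain_comm s :
    sub_rng s -> {in s &, forall x y, x * y = 0 -> x = 0 \/ y = 0} ->
  {in s &, commutative *%R}.
Proof.
move=> ss sdom x0 y0 sx0 sy0.
have [-> | nzx] := eqVneq x0 0; first by rewrite mul0r mulr0.
have [e se he] := sub_rng_domain_unit ss sdom sx0 nzx.
have nze : e != 0.
  by apply: contraNneq nzx => e0; rewrite -(proj1 (he _ sx0)) e0 mul0r.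
pose T := seq_sub s.
pose zT : T := SeqSub (sub_rng0 ss se).
pose oT : T := SeqSub se.
pose nT (a : T) : T := SeqSub (sub_rngN ss (valP a)).
pose aT (a b : T) : T := SeqSub (sub_rngD ss (valP a) (valP b)).
pose mT (a b : T) : T := SeqSub (proj2 ss _ _ (valP a) (valP b)).
have aA : associative aT by move=> a b c; apply: val_inj; rewrite /= addrA.
have aC : commutative aT by move=> a b; apply: val_inj; rewrite /= addrC.
have a0 : left_id zT aT by move=> a; apply: val_inj; rewrite /= add0r.
have aN : left_inverse zT nT aT by move=> a; apply: val_inj; rewrite /= addNr.
have mA : associative mT by move=> a b c; apply: val_inj; rewrite /= mulrA.
have m1 : left_id oT mT.
  by move=> a; apply: val_inj; rewrite /= (proj1 (he _ (valP a))).
have m1r : right_id oT mT.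
  by move=> a; apply: val_inj; rewrite /= (proj2 (he _ (valP a))).
have mDl : left_distributive mT aT.
  by move=> a b c; apply: val_inj; rewrite /= mulrDl.
have mDr : right_distributive mT aT.
  by move=> a b c; apply: val_inj; rewrite /= mulrDr.
have nz10 : oT != zT by apply: contraNneq nze => /(congr1 val) /= ->.
pose zC := GRing.isZmodule.Build T aA aC a0 aN.
pose zM : zmodType := HB.pack T zC.
pose rC := GRing.Zmodule_isNzRing.Build zM mA m1 m1r mDl mDr nz10.
pose rM : finNzRingType := HB.pack T zC rC.
pose uC := FinRing.isNzRing.Build rM.
pose uM : finUnitRingType := HB.pack rM uC.
have dom : GRing.integral_domain_axiom uM.
  move=> a b /(congr1 val) /= /(sdom _ _ (valP a) (valP b)) [] h0.
    by apply/orP; left; apply/eqP/val_inj.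
  by apply/orP; right; apply/eqP/val_inj.
by have /(congr1 val) := finDomain_mulrC dom (SeqSub sx0) (SeqSub sy0).
Qed.

(* Away from the domain case, the annihilator [I] of a zero divisor and the
   annihilator of [I] are proper ideals, commutative by induction.  In a reduced
   ring a commutative ideal is central, hence is killed by all commutators; so a
   commutator lies in both annihilators and squares to zero. *)
Lemma reduced_sub_rng_comm s :
    sub_rng s -> {in s, forall x, x * x = 0 -> x = 0} ->
  {in s &, commutative *%R}.
Proof.
have [n] := ubnP (size (undup s)); elim: n s => // n IHn s.
rewrite ltnS => le_sn ss sred; have [sB sM] := ss.
(* [(b * a) ^+ 2] contains the factor [a * b], and in [insert] below [(a * r * b) ^+ 2] contains
   [b * a]; so both squares vanish. *)
have swap a b : a \in s -> b \in s -> a * b = 0 -> b * a = 0.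
  move=> sa sb ab0; apply: sred; first by rewrite sM.
  by rewrite mulrA -[b * a * b]mulrA ab0 mulr0 mul0r.
have insert a b r : a \in s -> b \in s -> r \in s -> a * b = 0 ->
    a * r * b = 0.
  move=> sa sb sr ab0; apply: sred; first by rewrite !sM.
  by rewrite !mulrA -[a * r * b * a]mulrA (swap a b) // mulr0 !mul0r.
have [dom | ] := boolP (all (fun a => all (fun b =>
    (a * b == 0) ==> ((a == 0) || (b == 0))) s) s).
  apply: sub_rng_domain_comm => // x y sx sy xy0.
  move/allP/(_ _ sx)/allP/(_ _ sy): dom; rewrite xy0 eqxx /=.
  by case/orP=> /eqP; [left | right].
case/allPn=> a sa /allPn[b sb].
rewrite negb_imply negb_or => /and3P[/eqP ab0 nza nzb].
pose I := [seq r <- s | a * r == 0].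
pose J := [seq r <- s | all (fun i => i * r == 0) I].
have memI r : (r \in I) = (a * r == 0) && (r \in s) by rewrite mem_filter.
have sI r : r \in I -> r \in s by rewrite memI => /andP[].
have memJP r : reflect (r \in s /\ {in I, forall i, i * r = 0}) (r \in J).
  rewrite mem_filter andbC; apply: (iffP andP) => -[sr rI]; split=> //.
    by move=> i Ii; apply/eqP/(allP rI).
  by apply/allP=> i Ii; rewrite rI.
have sJ r : r \in J -> r \in s by case/memJP.
have idealI r t : r \in I -> t \in s -> (r * t \in I) && (t * r \in I).
  rewrite !memI => /andP[/eqP ar0 sr] st.
  by rewrite mulrA ar0 mul0r eqxx mulrA insert ?eqxx ?sM.
have idealJ r t : r \in J -> t \in s -> (r * t \in J) && (t * r \in J).
  move=> /memJP[sr rI] st; apply/andP; split; apply/memJP; split; rewrite ?sM //.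
    by move=> i Ii; rewrite mulrA rI ?mul0r.
  by move=> i Ii; rewrite mulrA insert ?rI // sI.
have rngI : sub_rng I.
  split=> x y Ix Iy; last by case/andP: (idealI _ _ Ix (sI _ Iy)).
  move: Ix Iy; rewrite !memI => /andP[/eqP ax sx] /andP[/eqP ay sy].
  by rewrite mulrBr ax ay subrr eqxx sB.
have rngJ : sub_rng J.
  split=> x y Jx Jy; last by case/andP: (idealJ _ _ Jx (sJ _ Jy)).
  case/memJP: Jx => sx xI; case/memJP: Jy => sy yI.
  by apply/memJP; split=> [|i Ii]; rewrite ?sB // mulrBr xI // yI // subrr.
have small t r : {subset t <= s} -> r \in s -> r \notin t ->
    (size (undup t) < n)%N.
  move=> sts sr tr; apply: leq_trans le_sn.
  rewrite ltnNge; apply/negP => le_st.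
  have [||_ eq_st] := @uniq_min_size _ (undup t) (undup s) (undup_uniq t).
  - by move=> x; rewrite !mem_undup; apply: sts.
  - exact: le_st.
  by move: sr tr; rewrite -mem_undup -eq_st mem_undup => ->.
(* [I] misses [a], since [a * a = 0] would force [a = 0]. As [b] lies in [I], [J] misses [b] for the
   same reason, so induction applies to both. *)
have commI : {in I &, commutative *%R}.
  apply: IHn => //; last by move=> x /sI; apply: sred.
  apply: (small _ a) => //; rewrite memI sa andbT.
  by apply: contra nza => /eqP/(sred _ sa)/eqP.
have commJ : {in J &, commutative *%R}.
  apply: IHn => //; last by move=> x /sJ; apply: sred.
  have Ib : b \in I by rewrite memI ab0 eqxx.
  apply: (small _ b) => //; apply: contra nzb => /memJP[_ /(_ _ Ib)].
  by move/(sred _ sb)/eqP.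
(* [i] commutes with [c] and with [x * c], both in [K]; hence [i * (x * c) = x * (i * c)], that is,
   [c * c = 0]. *)
have central K : {subset K <= s} -> sub_rng K ->
    (forall r t, r \in K -> t \in s -> (r * t \in K) && (t * r \in K)) ->
    {in K &, commutative *%R} -> {in K & s, forall i x, i * x = x * i}.
  move=> sKs [KB _] ideal commK i x Ki sx; apply/eqP; rewrite -subr_eq0.
  have [Kix Kxi] := andP (ideal _ _ Ki sx).
  apply/eqP/sred; first by rewrite sKs ?KB.
  set c := i * x - x * i; have Kc : c \in K by rewrite KB.
  have [Kcx Kxc] := andP (ideal _ _ Kc sx).
  by rewrite {1}/c mulrBl -!mulrA [i * _]commK // -mulrA [c * i]commK // subrr.
move=> x y sx sy; apply/eqP; rewrite -subr_eq0; apply/eqP.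
set c := x * y - y * x; have sc : c \in s by rewrite sB ?sM.
(* [i] and [i * x] are both central, so [i * x * y = y * (i * x) = i * y * x]. *)
have kill K : {subset K <= s} ->
    (forall r t, r \in K -> t \in s -> (r * t \in K) && (t * r \in K)) ->
    {in K & s, forall i x, i * x = x * i} -> {in K, forall i, i * c = 0}.
  move=> sKs ideal cenK i Ki; have [Kix _] := andP (ideal _ _ Ki sx).
  by rewrite mulrBr !mulrA (cenK _ y Kix sy) mulrA -(cenK _ y Ki sy) subrr.
have Jc : c \in J.
  by apply/memJP; split=> //; apply: kill => //; apply: central.
apply: sred => //.
exact: kill sJ idealJ (central _ sJ rngJ idealJ commJ) _ Jc.
Qed.

End FiniteRng.

(** * Rings in which 2 = 0 *)

Section Char2.
Local Open Scope ring_scope.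

Variable R : pzRingType.
Hypothesis R2 : 1 + 1 = 0 :> R.
Implicit Types a b r : R.

Lemma char2_addrr r : r + r = 0.
Proof. by rewrite -[r]mul1r -mulrDl R2 mul0r. Qed.

Lemma char2_oppr r : - r = r.
Proof. by apply/eqP; rewrite eq_sym -addr_eq0 char2_addrr. Qed.

Lemma char2_addK r : cancel (+%R r) (+%R r).
Proof. by move=> a; rewrite addrA char2_addrr add0r. Qed.

Lemma char2_add_eq0 a b : a + b = 0 -> a = b.
Proof. by move/eqP; rewrite addr_eq0 char2_oppr => /eqP. Qed.

Lemma char2_sqrD a b : a * b = b * a -> (a + b) * (a + b) = a * a + b * b.
Proof.
move=> cab; rewrite mulrDl !mulrDr cab addrA -[a * a + _ + _]addrA.
by rewrite char2_addrr addr0.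
Qed.

Lemma char2_expr1D r k : (1 + r) ^+ (2 ^ k) = 1 + r ^+ (2 ^ k).
Proof.
elim: k => [|k IHk]; first by rewrite !expr1.
by rewrite expnSr !exprM IHk !expr2 char2_sqrD ?mul1r // mulr1.
Qed.

Lemma char2_mulrn r m : r *+ m = r *+ odd m.
Proof.
elim: m => // m IHm; rewrite mulrS IHm /=.
by case: (odd m); rewrite ?addr0 // char2_addrr.
Qed.

(* In [F_2[t]/(t^m - 1)] with [m] odd, [1 + t + e] (with [e = sum_i t^i]) is
   [1] where [t = 1] and [1 + t] elsewhere, hence is a unit. *)
Lemma char2_cyclic_unit (x : R) m (e := \sum_(i < m) x ^+ i) :
    odd m -> x ^+ m = 1 ->
  [/\ x * e = e, e * x = e, e * e = e & invertible (1 + x + e)].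
Proof.
move=> odd_m xm.
have xe : x * e = e.
  case: m @e odd_m xm => // m e _ xm.
  rewrite /e mulr_sumr [RHS]big_ord_recl [LHS]big_ord_recr /=.
  rewrite -exprS xm addrC expr0; congr (_ + _).
  by apply: eq_bigr => i _; rewrite -exprS.
have cxe : x * e = e * x.
  rewrite /e mulr_sumr mulr_suml; apply: eq_bigr => i _.
  by rewrite -exprS -exprSr.
have ex : e * x = e by rewrite -cxe.
have xie i : x ^+ i * e = e.
  by elim: i => [|i IHi]; rewrite ?mul1r // exprS -mulrA IHi.
have ee : e * e = e.
  rewrite {1}/e mulr_suml (eq_bigr (fun=> e)) => [|i _]; last exact: xie.
  by rewrite sumr_const card_ord char2_mulrn odd_m.
split=> //.
(* [s] inverts [1 + x] up to [e]: the product is [x + x ^+ 2 + ... + x ^+ m.-1 = 1 + e]. *)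
pose h := m./2; pose s := \sum_(i < h) x ^+ i.*2.+1.
have def_m : m = h.*2.+1 by rewrite /h -[LHS]odd_double_half odd_m.
have xs : (1 + x) * s = 1 + e.
  rewrite /e def_m /s; elim: (h) => [|k IHk].
    by rewrite big_ord0 mulr0 big_ord1 expr0 R2.
  rewrite big_ord_recr /= mulrDr IHk doubleS !big_ord_recr /= -!addrA.
  by do 2!congr (_ + _); rewrite mulrDl mul1r -exprS.
have cxs : s * x = x * s.
  rewrite mulr_sumr mulr_suml; apply: eq_bigr => i _.
  by rewrite -exprS -exprSr.
have ces : e * s = s * e.
  rewrite /s mulr_sumr mulr_suml; apply: eq_bigr => i _; rewrite xie.
  elim: (i.*2.+1) => [|j IHj]; first by rewrite mulr1.
  by rewrite exprSr mulrA IHj.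
have [c es] : exists c : bool, e * s = e *+ c.
  exists (odd h); rewrite ces mulr_suml (eq_bigr (fun=> e)) => [|i _].
    by rewrite sumr_const card_ord char2_mulrn.
  exact: xie.
(* The correction [d] is killed by [1 + x] and makes [e * (s + d) = e] for either value of [c]. *)
pose d := e *+ ~~ c.
have cd : e * d = d by rewrite /d; case: (c); rewrite ?mulr0.
have cd' : d * e = d by rewrite /d; case: (c); rewrite ?mul0r.
have xd : x * d = d by rewrite /d; case: (c); rewrite ?mulr0.
have dx : d * x = d by rewrite /d; case: (c); rewrite ?mul0r.
have key : e + (e *+ c + d) = 0.
  by rewrite /d; case: (c); rewrite /= ?addr0 ?add0r char2_addrr.
exists (s + d); split.
  rewrite mulrDl mulrDr xs [(1 + x) * d]mulrDl mul1r xd char2_addrr addr0.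
  by rewrite mulrDr es cd -addrA key addr0.
rewrite mulrDl ![_ * (1 + x + e)]mulrDr.
rewrite [s * _]mulrDr mulr1 cxs -{1}[s]mul1r -mulrDl xs -ces es.
by rewrite [d * _]mulrDr mulr1 dx char2_addrr add0r cd' -!addrA key addr0.
Qed.

End Char2.

(** * Changing direct and semidirect decompositions *)

Section GroupFacts.
Local Open Scope group_scope.
Variable gT : finGroupType.
Implicit Types A C D H K P G : {group gT}.

(** A shear of the direct product. If [(w * b) ^+ i] is in [D], then [w ^+ i = 1], so [#[w]] divides
    [i] and [b ^+ i = 1] as well. It yields a second decomposition with the same factor [D]. *)
Lemma dprod_cycleM (w b : gT) D K :
  <[w]> \x D = K -> b \in 'Z(D) -> b ^+ #[w] = 1 -> <[w * b]> \x D = K.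
Proof.
move=> defK /centerP[Db cDb] bw; have [_ eqK cwD tiwD] := dprodP defK.
have cDw d : d \in D -> commute w d.
  by move=> Dd; apply: commute_sym; apply: (centsP cwD); rewrite ?cycle_id.
have wbX i : (w * b) ^+ i = w ^+ i * b ^+ i by apply: expgMn; apply: cDw.
have cwbD : D \subset 'C(<[w * b]>).
  rewrite cent_cycle; apply/subsetP=> d Dd; apply/cent1P.
  exact: commuteM (commute_sym (cDw d Dd)) (commute_sym (cDb d Dd)).
rewrite dprodE //.
  have sDK : D \subset K by rewrite -eqK mulG_subr.
  have Kw : w \in K by rewrite -cycle_subG -eqK mulG_subl.
  apply/eqP; rewrite eqEsubset mul_subG //=; last first.
    by rewrite cycle_subG groupM // (subsetP sDK).
  rewrite -eqK; apply/subsetP=> _ /mulsgP[_ d /cycleP[i ->] Dd ->].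
  have -> : w ^+ i * d = (w * b) ^+ i * (b ^- i * d) by rewrite wbX !mulgA mulgK.
  by rewrite mem_mulg ?mem_cycle // groupM // groupV groupX.
apply/trivgP/subsetP=> _ /setIP[/cycleP[i ->]]; rewrite wbX => Dwb.
have : w ^+ i \in <[w]> :&: D.
  by rewrite inE mem_cycle -(groupMr _ (groupX i Db)).
rewrite tiwD => /set1P wi; rewrite inE wi mul1g.
move/eqP: wi; rewrite -order_dvdn => /dvdnP[j ->].
by rewrite mulnC expgM bw expg1n.
Qed.

Lemma dprod_sdprod A H P C G :
    P ><| C = G -> A \x H = P -> A \subset 'C(C) -> C \subset 'N(H) ->
  A \x (H <*> C) = G /\ H ><| C = H <*> C.
Proof.
move=> /sdprodP[_ eqG nPC tiPC] /dprodP[_ eqP cAH tiAH] cAC nHC.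
have sHP : H \subset P by rewrite -eqP mulG_subr.
have sAP : A \subset P by rewrite -eqP mulG_subl.
have tiHC : H :&: C = 1 by apply/trivgP; rewrite -tiPC setSI.
split; last by rewrite sdprodEY.
rewrite dprodE /=.
- by rewrite norm_joinEr // mulgA eqP.
- by rewrite join_subG cAH centsC.
(* [A] lies in [P], and by the modular law [P] meets [H * C] in [H * (P :&: C) = H]. *)
rewrite norm_joinEr // -(setIidPl sAP) -setIA [P :&: _]setIC -group_modl //.
by rewrite setIC [C :&: P]setIC tiPC mulg1 setIC.
Qed.

End GroupFacts.

(** * The structure of a fully realizable group *)

Section FullRing.
Local Open Scope ring_scope.

Variables (gT : finGroupType) (G : {group gT}) (R : pzRingType).
Variable iota : gT -> R.
Hypothesis isoU : units_isom G iota.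
Hypothesis full : forall phi : {morphism G >-> gT}, (phi @* G)%g \subset G ->
  exists psi : {rmorphism R -> R}, {in G, forall x, psi (iota x) = iota (phi x)}.
Implicit Types (x y : gT) (r u : R).

Lemma iotaM x y : x \in G -> y \in G -> iota (x * y)%g = iota x * iota y.
Proof. by case: isoU => iM _ _; apply: iM. Qed.

Lemma iota_inj : {in G &, injective iota}.
Proof. by case: isoU. Qed.

Lemma invertible_iota u : invertible u -> exists2 x, x \in G & iota x = u.
Proof. by case: isoU => _ _ iU /iU. Qed.

Lemma iota1 : iota 1%g = 1.
Proof.
have [|x Gx x1] := @invertible_iota 1; first by exists 1; rewrite mulr1.
by rewrite -[LHS]mulr1 -{1}x1 -iotaM ?mul1g.
Qed.

Lemma iotaX x n : x \in G -> iota (x ^+ n)%g = iota x ^+ n.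
Proof.
move=> Gx; elim: n => [|n IHn]; first by rewrite iota1.
by rewrite expgS iotaM ?groupX // IHn exprS.
Qed.

Lemma iotaV x : x \in G -> iota x * iota x^-1%g = 1.
Proof. by move=> Gx; rewrite -iotaM ?groupV // mulgV iota1. Qed.

Lemma iota_lreg x r s : x \in G -> iota x * r = iota x * s -> r = s.
Proof.
move=> Gx /(congr1 ( *%R (iota x^-1%g))).
by rewrite !mulrA -iotaM ?groupV // mulVg iota1 !mul1r.
Qed.

Lemma extend_endo (f : gT -> gT) :
    {in G &, {morph f : x y / (x * y)%g}} -> {in G, forall x, f x \in G} ->
  exists psi : {rmorphism R -> R}, {in G, forall x, psi (iota x) = iota (f x)}.
Proof.
move=> fM fG; pose phi := Morphism fM.
have [|psi psiE] := @full phi; last by exists psi.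
by apply/subsetP=> _ /morphimP[x _ Gx ->]; apply: fG.
Qed.

(** The unit [- 1] is fixed by every ring endomorphism, but the extension of the trivial group
    endomorphism sends it to 1. *)
Lemma full_char2 : 1 + 1 = 0 :> R.
Proof.
have [||psi psiE] := @extend_endo (fun=> 1%g).
- by move=> x y _ _; rewrite mulg1.
- by move=> x _; apply: group1.
have [|x Gx xN1] := @invertible_iota (- 1).
  by exists (- 1); rewrite mulrNN mulr1.
have := psiE x Gx; rewrite xN1 rmorphN rmorph1 iota1.
by move/eqP; rewrite eq_sym -addr_eq0 => /eqP.
Qed.

Let R2 := full_char2.

(** The retraction [rho] followed by the two projections of [K] gives endomorphisms of [G]. This
    serves for [K = C], and for [K = G] with [rho] the identity: a unit from [K] is determined by
    its two images. *)
Lemma proj_endos (K A B : {group gT}) (rho : gT -> gT) :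
    K \subset G -> {in G &, {morph rho : x y / (x * y)%g}} ->
    {in G, forall x, rho x \in K} -> {in K, forall x, rho x = x} ->
    (A \x B)%g = K ->
  exists psiA psiB : {rmorphism R -> R},
   [/\ {in A, forall x, psiA (iota x) = iota x /\ psiB (iota x) = 1},
       {in B, forall x, psiA (iota x) = 1 /\ psiB (iota x) = iota x}
     & {in K, forall x, iota x = psiA (iota x) * psiB (iota x)}].
Proof.
move=> sKG retractM rhoK rhoid defK; have [_ eqK cAB tiAB] := dprodP defK.
have [nAK nBK] := dprod_normal2 defK.
have sAK := normal_sub nAK; have sBK := normal_sub nBK.
have cBA : (B \in [complements to A in K])%g by apply/complP.
have cAB' : (A \in [complements to B in K])%g by rewrite complgC.
have eqK' : (B * A)%g = K by case/complP: cAB'.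
have proj (X Y : {group gT}) : (Y \in [complements to X in K])%g -> (X <| K)%g ->
    exists psi : {rmorphism R -> R},
      {in G, forall x, psi (iota x) = iota (remgr X Y (rho x))}.
  move=> cXY nXK; have [_ eqXY] := complP cXY.
  apply: extend_endo => [x y Gx Gy | x Gx] /=.
    by rewrite retractM // (remgrM cXY) ?rhoK.
  apply: (subsetP sKG); rewrite -eqXY (subsetP (mulG_subr _ _)) //.
  by rewrite mem_remgr // eqXY rhoK.
have [psiA psiAE] := proj _ _ cAB' nBK; have [psiB psiBE] := proj _ _ cBA nAK.
have tiBA : B :&: A = 1%g by rewrite setIC.
exists psiA, psiB; split=> x.
- move=> Ax; have Kx := subsetP sAK x Ax; have Gx := subsetP sKG x Kx.
  by rewrite psiAE // psiBE // rhoid // remgr_id // remgr1 // iota1.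
- move=> Bx; have Kx := subsetP sBK x Bx; have Gx := subsetP sKG x Kx.
  by rewrite psiAE // psiBE // rhoid // remgr1 // remgr_id // iota1.
rewrite -eqK => /mulsgP[a b Aa Bb ->].
have [Ka Kb] := (subsetP sAK a Aa, subsetP sBK b Bb).
have [Ga Gb] := (subsetP sKG a Ka, subsetP sKG b Kb).
rewrite psiAE ?psiBE ?groupM // !rhoid ?groupM // (remgrMid tiAB) //.
have -> : (a * b = b * a)%g by apply/commute_sym; exact: (centsP cAB).
by rewrite (remgrMid tiBA) // -iotaM // (centsP cAB b).
Qed.

(** * The complement of the normal Sylow 2-subgroup *)

Section Complement.

Variables P C : {group gT}.
Hypothesis defG : (P ><| C)%g = G.
Hypothesis oddC : odd #|C|.

Let tiPC : P :&: C = 1%g. Proof. by case/sdprodP: defG. Qed.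
Let eqPC : (P * C)%g = G. Proof. by case/sdprodP: defG. Qed.
Let nsPG : (P <| G)%g. Proof. by case/sdprod_context: defG. Qed.
Let complPC : (C \in [complements to P in G])%g. Proof. exact/complP. Qed.
Let sCG : C \subset G. Proof. by rewrite -eqPC mulG_subr. Qed.
Let sPG : P \subset G. Proof. exact: normal_sub. Qed.
Let nPC : (C \subset 'N(P))%g. Proof. by case/sdprodP: defG. Qed.

Lemma retractM : {in G &, {morph remgr P C : x y / (x * y)%g}}.
Proof. exact: remgrM. Qed.

Lemma mem_retract x : x \in G -> remgr P C x \in C.
Proof. by move=> Gx; rewrite mem_remgr ?eqPC. Qed.

Section FixedRing.

Variable psi0 : {rmorphism R -> R}.
Hypothesis psi0E : {in G, forall x, psi0 (iota x) = iota (remgr P C x)}.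

Lemma fixed_iota x : x \in C -> psi0 (iota x) = iota x.
Proof. by move=> Cx; rewrite psi0E ?(subsetP sCG) // remgr_id. Qed.

Lemma fixed_unit u : psi0 u = u -> invertible u ->
  exists2 x, x \in C & iota x = u.
Proof.
move=> u_fix /invertible_iota[x Gx xu]; exists x => //.
have Cx := mem_retract Gx; rewrite -xu psi0E // in u_fix.
by rewrite -(iota_inj (subsetP sCG _ Cx) Gx u_fix).
Qed.

(* A square-zero [r] yields a unit [1 + r] of order dividing 2. *)
Lemma fixed_reduced r : psi0 r = r -> r * r = 0 -> r = 0.
Proof.
move=> r_fix rr.
have sq1 : (1 + r) * (1 + r) = 1.
  by rewrite char2_sqrD ?mul1r ?mulr1 // rr addr0.
have [||x Cx xE] := @fixed_unit (1 + r).
- by rewrite rmorphD rmorph1 r_fix.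
- by exists (1 + r).
have Gx := subsetP sCG x Cx.
have xx : (x ^+ 2 = 1)%g.
  by apply: iota_inj; rewrite ?groupX ?group1 // iotaX // iota1 xE expr2.
have : (#[x]%g %| gcdn 2 #|C|)%N by rewrite dvdn_gcd order_dvdn xx eqxx order_dvdG.
have /eqP-> : coprime 2 #|C| by rewrite coprime2n.
rewrite dvdn1 order_eq1 => /eqP x1.
by apply: (addrI 1); rewrite -xE x1 iota1 addr0.
Qed.

Lemma complement_abelian : abelian C.
Proof.
(* As 2 = 0, subset sums already form the whole additive span of the image of [C]. This finite
   subring is fixed by [psi0], hence reduced. *)
pose s := [seq \sum_(x in X) iota x | X : {set gT} <- enum (powerset C)].
have sP r : reflect (exists2 X : {set gT},
    X \subset C & r = \sum_(x in X) iota x) (r \in s).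
  apply: (iffP mapP) => -[X sX ->]; exists X => //; move: sX.
    by rewrite mem_enum powersetE.
  by rewrite mem_enum powersetE.
have s_iota x : x \in C -> iota x \in s.
  by move=> Cx; apply/sP; exists [set x]; rewrite ?sub1set // big_set1.
have s0 : 0 \in s by apply/sP; exists set0; rewrite ?sub0set // big_set0.
have sDi r x : r \in s -> x \in C -> r + iota x \in s.
  case/sP=> X sXC -> Cx; apply/sP.
  have [Xx | nXx] := boolP (x \in X).
    exists (X :\ x); first by rewrite (subset_trans (subD1set _ _)).
    by rewrite (big_setD1 x Xx) /= [LHS]addrC addrA char2_addrr // add0r.
  exists (x |: X); first by rewrite subUset sub1set Cx.
  by rewrite big_setU1 //= addrC.
have sD : {in s &, forall r t, r + t \in s}.
  move=> r t sr /sP[X sXC ->].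
  pose Q u := forall r, r \in s -> r + u \in s.
  suff: Q (\sum_(x in X) iota x) by apply.
  apply: big_ind => [r' sr' | u v Qu Qv r' sr' | x Xx r' sr'].
  - by rewrite addr0.
  - by rewrite addrA; apply/Qv/Qu.
  - by apply: sDi => //; apply: (subsetP sXC).
have sM : {in s &, forall r t, r * t \in s}.
  move=> _ _ /sP[X sXC ->] /sP[Y sYC ->].
  rewrite mulr_suml; apply: (big_ind (fun r => r \in s)) => [|u v|x Xx] //.
    exact: sD.
  rewrite mulr_sumr; apply: (big_ind (fun r => r \in s)) => [|u v|y Yy] //.
    exact: sD.
  have [Cx Cy] := (subsetP sXC x Xx, subsetP sYC y Yy).
  by rewrite -iotaM ?(subsetP sCG) // s_iota ?groupM.
have rng_s : sub_rng s by split=> // r t sr st; rewrite (char2_oppr R2) sD.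
have red_s : {in s, forall r, r * r = 0 -> r = 0}.
  move=> _ /sP[X sXC ->]; apply: fixed_reduced; rewrite rmorph_sum.
  by apply: eq_bigr => x Xx; rewrite fixed_iota ?(subsetP sXC).
apply/centsP=> x Cx y Cy; have [Gx Gy] := (subsetP sCG x Cx, subsetP sCG y Cy).
apply: iota_inj; rewrite ?groupM // !iotaM //.
exact: (reduced_sub_rng_comm rng_s) (s_iota x Cx) (s_iota y Cy).
Qed.

Lemma complement_expg3 x : x \in C -> (x ^+ 3 = 1)%g.
Proof.
move=> Cx; have Gx := subsetP sCG x Cx.
have [||sig sigE] := @extend_endo (fun g => (remgr P C g)^-1%g).
- move=> g h Gg Gh /=; rewrite retractM // invMg.
  by apply: (centsP complement_abelian); rewrite groupV mem_retract.
- by move=> g Gg; rewrite groupV (subsetP sCG) ?mem_retract.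
pose X := iota x; pose Y := iota x^-1%g; pose m := #[x]%g.
have Cx' : x^-1%g \in C by rewrite groupV.
have sigC y : y \in C -> sig (iota y) = iota y^-1%g.
  by move=> Cy; rewrite sigE ?(subsetP sCG) // remgr_id.
have odd_m : odd m by apply: dvdn_odd oddC; apply: order_dvdG.
have Xm : X ^+ m = 1 by rewrite -iotaX // expg_order iota1.
have Ym : Y ^+ m = 1.
  by rewrite -iotaX ?groupV // expgVn expg_order invg1 iota1.
have [Xe eX ee Uu] := char2_cyclic_unit R2 odd_m Xm.
have [Ye' e'Y e'e' _] := char2_cyclic_unit R2 odd_m Ym.
set e := \sum_(i < m) X ^+ i in Xe eX ee Uu.
set e' := \sum_(i < m) Y ^+ i in Ye' e'Y e'e'.
have XY : X * Y = 1 by apply: iotaV.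
have YX : Y * X = 1 by rewrite /X /Y -{2}[x]invgK iotaV ?groupV.
have Xe' : X * e' = e' by rewrite -{1}Ye' mulrA XY mul1r.
have eY : e * Y = e by rewrite -{1}eX -mulrA XY mulr1.
(* Both equal [e * e']: powers of [X] fix [e'], powers of [Y] fix [e], and the number [m] of terms
   is odd. *)
have ee' : e' = e.
  transitivity (e * e').
    rewrite /e mulr_suml (eq_bigr (fun=> e')) => [|i _].
      by rewrite sumr_const card_ord char2_mulrn // odd_m.
    by elim: (val i) => [|j IHj]; rewrite ?mul1r // exprS -mulrA IHj.
  rewrite /e' mulr_sumr (eq_bigr (fun=> e)) => [|i _].
    by rewrite sumr_const card_ord char2_mulrn // odd_m.
  elim: (val i) => [|j IHj]; first by rewrite mulr1.
  by rewrite exprSr mulrA IHj.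
have sig_e : sig e = e.
  rewrite -{2}ee' rmorph_sum; apply: eq_bigr => i _.
  by rewrite rmorphXn /= sigC.
have e_fix : psi0 e = e.
  by rewrite rmorph_sum; apply: eq_bigr => i _; rewrite rmorphXn /= fixed_iota.
have [|y Cy yE] := fixed_unit _ Uu.
  by rewrite !rmorphD rmorph1 /= e_fix fixed_iota.
have Gy := subsetP sCG y Cy.
(* Multiplied out, this reads [X + Y + e = 1]. With [e = 1 + X + Y], the relation [X * e = e]
   becomes [X * X = Y]. *)
have yV : (1 + X + e) * (1 + Y + e) = 1.
  have <- : sig (iota y) = 1 + Y + e by rewrite yE !rmorphD rmorph1 /= sig_e sigC.
  by rewrite -yE sigC // iotaV.
have Ue : (1 + X) * e = 0 by rewrite mulrDl mul1r Xe char2_addrr.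
have eV : e * (1 + Y) = 0 by rewrite mulrDr mulr1 eY char2_addrr.
have UV : (1 + X) * (1 + Y) = X + Y.
  by rewrite mulrDl mul1r mulrDr mulr1 XY [X + 1]addrC addrACA R2 add0r addrC.
have eXY : e = 1 + X + Y.
  move: yV; rewrite mulrDl !(mulrDr _ (1 + Y)) UV Ue eV ee addr0 add0r => XYe.
  by rewrite -[LHS](char2_addK R2 (X + Y)) XYe addrC addrA.
have XX : X * X = Y.
  apply: (addrI (1 + X)); rewrite -eXY -{1}Xe eXY !mulrDr mulr1 XY.
  by rewrite [RHS]addrC addrA.
have xx : (x * x = x^-1)%g.
  by apply: iota_inj; rewrite ?groupM ?groupV // iotaM.
by rewrite !expgS expg0 mulg1 xx mulgV.
Qed.

End FixedRing.

Lemma retract_complement : exists psi : {rmorphism R -> R},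
  {in G, forall x, psi (iota x) = iota (remgr P C x)}.
Proof.
apply: extend_endo => [x y Gx Gy|x Gx]; first exact: retractM.
by rewrite (subsetP sCG) ?mem_retract.
Qed.

Lemma complement_abelem : (3.-abelem C)%g.
Proof.
have [psi0 psi0E] := retract_complement.
apply/abelemP=> //; split.
  exact: (complement_abelian psi0E).
exact: (complement_expg3 psi0E).
Qed.

(** The unit [1 + (1 + A) * E] comes from [C] and has images [A] and 1 under the two projections, so
    it equals [A]. Hence [(1 + A) * (1 + E) = 0], where [1 + E = (1 + B) * B] and [B] is
    invertible. *)
Lemma complement_annih a b (D : {group gT}) :
    (<[a]> \x D)%g = C -> b \in D -> (1 + iota a) * (1 + iota b) = 0.
Proof.
move=> defC Db; have [_ eqC _ _] := dprodP defC.
have [psi0 psi0E] := retract_complement.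
have sDC : D \subset C by rewrite -eqC mulG_subr.
have Ca : a \in C by rewrite -cycle_subG -eqC mulG_subl.
have Cb := subsetP sDC b Db.
have [Ga Gb] := (subsetP sCG a Ca, subsetP sCG b Cb).
have [abC exC] := abelemP (isT : prime 3) complement_abelem.
have [psiA [psiB [psi_a psi_D psi_C]]] : exists psiA psiB : {rmorphism R -> R},
   [/\ {in <[a]>%g, forall x, psiA (iota x) = iota x /\ psiB (iota x) = 1},
       {in D, forall x, psiA (iota x) = 1 /\ psiB (iota x) = iota x}
     & {in C, forall x, iota x = psiA (iota x) * psiB (iota x)}].
  apply: (proj_endos sCG retractM) defC => x.
    exact: mem_retract.
  by move=> Cx; rewrite remgr_id //; case/sdprodP: defG.
have [aA aB] := psi_a a (cycle_id a); have [bA bB] := psi_D b Db.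
pose A := iota a; pose B := iota b; pose E := 1 + B + B * B.
have cAB : A * B = B * A by rewrite /A /B -!iotaM // (centsP abC).
have cube1 x : x \in C -> iota x * iota x * iota x = 1.
  move=> Cx; have Gx := subsetP sCG x Cx.
  rewrite -[_ * iota x]mulrA -[iota x * (_ * _)]/(iota x ^+ 3).
  by rewrite -iotaX // exC ?iota1.
have [A3 B3] := (cube1 a Ca, cube1 b Cb).
have BE : B * E = E.
  by rewrite /E !mulrDr mulr1 !mulrA B3 [LHS]addrC addrA.
have EE : E * E = E.
  by rewrite {1}/E !mulrDl -mulrA !BE mul1r char2_addrr // add0r.
have cAE : A * E = E * A.
  by rewrite /E !mulrDr !mulrDl mulr1 mul1r cAB mulrA cAB -!mulrA cAB.
(* Relative to the idempotent [E], this element is [A] on one component and 1 on the other. Its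
   inverse therefore has [A * A], the inverse of [A], in place of [A]. *)
have Uu : invertible (1 + (1 + A) * E).
  have inv r s : E * s = s * E -> r + s + r * s = 0 ->
      (1 + r * E) * (1 + s * E) = 1.
    move=> cEs rs0; transitivity (1 + (r + s + r * s) * E); last first.
      by rewrite rs0 mul0r addr0.
    rewrite [LHS]mulrDl mul1r.
    rewrite [r * E * _]mulrDr mulr1 -addrA; congr (1 + _).
    have -> : r * E * (s * E) = r * s * E.
      by rewrite -mulrA [E * (s * E)]mulrA cEs -mulrA EE mulrA.
    by rewrite !mulrDl addrCA addrA.
  have cEA : E * (1 + A) = (1 + A) * E by rewrite mulrDr mulr1 -cAE mulrDl mul1r.
  have cEAA : E * (1 + A * A) = (1 + A * A) * E.
    by rewrite mulrDr mulr1 mulrA -cAE -mulrA -cAE mulrA mulrDl mul1r.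
  have A_A2 : (1 + A) + (1 + A * A) = A + A * A.
    by rewrite addrACA R2 add0r.
  have A_A2M : (1 + A) * (1 + A * A) = A + A * A.
    rewrite mulrDl mul1r mulrDr mulr1 mulrA A3 [A + 1]addrC addrACA R2 add0r.
    exact: addrC.
  have A_A2M' : (1 + A * A) * (1 + A) = A + A * A.
    rewrite mulrDl mul1r mulrDr mulr1 A3 [A * A + 1]addrC addrACA R2 add0r //.
  exists (1 + (1 + A * A) * E); split; apply: inv => //.
    by rewrite A_A2 A_A2M char2_addrr.
  by rewrite [1 + A * A + _]addrC A_A2 A_A2M' char2_addrr.
have [|u Cu uE] := fixed_unit psi0E _ Uu.
  rewrite !(rmorphD, rmorphM) rmorph1 /=.
  by rewrite !(fixed_iota psi0E).
have uA : 1 + (1 + A) * E = A.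
  rewrite -uE psi_C // uE !(rmorphD, rmorphM) !rmorph1 /= aA aB bA bB.
  by rewrite R2 mul0r addr0 add0r !mulr1 addrA R2 add0r.
have AE : (1 + A) * E = 1 + A.
  by rewrite -[LHS](char2_addK R2 1) uA.
have : (1 + A) * (1 + B) * B = 0.
  have -> : (1 + A) * (1 + B) * B = (1 + A) * (1 + E).
    by rewrite -mulrA [(1 + B) * B]mulrDl mul1r /E -[1 + B + _]addrA (char2_addK R2).
  by rewrite mulrDr mulr1 AE char2_addrr.
move/(congr1 ( *%R^~ (iota b^-1%g))); rewrite -mulrA iotaV // mulr1.
by rewrite mul0r.
Qed.

(** The two relations add up to [iota a * (1 + iota b) * (1 + iota b) = 0]. Cancelling [iota a]
    leaves [1 + iota b * iota b = 0]. *)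
Lemma annih_twice a b : a \in G -> b \in G ->
    (1 + iota a) * (1 + iota b) = 0 ->
    (1 + iota (a * b)%g) * (1 + iota b) = 0 ->
  (b * b = 1)%g.
Proof.
move=> Ga Gb ann1; rewrite iotaM // => ann2.
have Bsq : (1 + iota b) * (1 + iota b) = 0.
  apply: (iota_lreg Ga); rewrite mulr0 mulrA.
  rewrite -[RHS](addr0 0) -{1}ann1 -{1}ann2 -mulrDl; congr (_ * _).
  by rewrite mulrDr mulr1 addrACA R2 add0r.
apply: iota_inj; rewrite ?groupM ?group1 //.
rewrite iotaM // iota1; apply: (char2_add_eq0 R2).
by rewrite addrC -Bsq char2_sqrD ?mul1r // mulr1.
Qed.

Lemma card_complement : #|C| = 1%N \/ #|C| = 3%N.
Proof.
have abelC := complement_abelem.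
have [abC exC] := abelemP (isT : prime 3) abelC.
have [->|/trivgPn[a Ca nta]] := eqVneq (C : {set gT}) 1%g.
  by left; rewrite cards1.
right.
have oa : #[a]%g = 3%N := abelem_order_p abelC Ca nta.
have /splitsP[D /complP[tiaD eqaD]] : [splits C, over <[a]>]%g.
  by apply: abelem_splits abelC _; rewrite cycle_subG.
have sDC : D \subset C by rewrite -eqaD mulG_subr.
have defC : (<[a]> \x D)%g = C.
  by rewrite dprodE // (sub_abelian_cent2 abC) ?cycle_subG.
have [D1|/trivgPn[b Db ntb]] := eqVneq (D : {set gT}) 1%g.
  by rewrite -eqaD D1 mulg1 -oa.
have Cb := subsetP sDC b Db.
have [Ga Gb] := (subsetP sCG a Ca, subsetP sCG b Cb).
(* A second decomposition with the same [D] gives the second relation; then [b * b = 1] contradicts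
   [b ^+ 3 = 1] with [b] nontrivial. *)
have defC' : (<[a * b]> \x D)%g = C.
  apply: dprod_cycleM defC _ _; last by rewrite oa exC.
  apply/centerP; split=> // d Dd; apply: (centsP abC) => //.
  exact: (subsetP sDC).
have ann1 := complement_annih defC Db.
have ann2 := complement_annih defC' Db.
have bb := annih_twice Ga Gb ann1 ann2.
by case/eqP: ntb; rewrite -(exC b Cb) !expgS expg0 mulg1 bb mulg1.
Qed.

(** * The Sylow 2-subgroup and its nilpotent elements *)

Section TwoPart.

Hypothesis sylP : (2.-Sylow(G) P)%g.
Hypothesis abP : abelian P.

(** By [unip_nil] and [nil_unip], these are exactly the nilpotent elements of [R]. *)
Definition unip r := exists2 p, p \in P & iota p = 1 + r.

Lemma unip_nil r : unip r -> exists k, r ^+ (2 ^ k) = 0.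
Proof.
case=> p Pp pE; exists (logn 2 #|P|); apply: (addrI 1).
rewrite -(char2_expr1D R2) -pE -iotaX ?(subsetP sPG) // addr0.
rewrite -(card_pgroup (pHall_pgroup sylP)).
by rewrite (expg_cardG Pp) iota1.
Qed.

(** [1 + r] is a unit of 2-power order, and the normal Sylow subgroup [P] contains every 2-element
    of [G]. *)
Lemma nil_unip r k : r ^+ (2 ^ k) = 0 -> unip r.
Proof.
move=> rk; have pow1 : (1 + r) ^+ (2 ^ k) = 1.
  by rewrite (char2_expr1D R2) rk addr0.
have [|x Gx xE] := invertible_iota (_ : invertible (1 + r)).
  have def : (2 ^ k = (2 ^ k).-1.+1)%N by rewrite prednK ?expn_gt0.
  exists ((1 + r) ^+ (2 ^ k).-1).
  by split; rewrite -?exprS -?exprSr -def pow1.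
exists x => //; rewrite (mem_normal_Hall sylP nsPG Gx).
suff : (#[x]%g %| 2 ^ k)%N by move/pnat_dvd; apply; rewrite pnatX.
rewrite order_dvdn; apply/eqP/iota_inj; rewrite ?groupX ?group1 //.
by rewrite iotaX // xE pow1 iota1.
Qed.

Lemma unip_iota p : p \in P -> unip (1 + iota p).
Proof. by exists p => //; rewrite (char2_addK R2). Qed.

Lemma unip_comm r s : unip r -> unip s -> r * s = s * r.
Proof.
case=> p Pp pE [q Pq qE].
have [Gp Gq] := (subsetP sPG p Pp, subsetP sPG q Pq).
have : iota p * iota q = iota q * iota p.
  by rewrite -!iotaM // (centsP abP).
rewrite pE qE !mulrDl !mulrDr !mulr1 !mul1r -!addrA => /addrI.
by rewrite !addrA [s + r]addrC => /addrI.
Qed.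

Lemma unipM r s : unip r -> unip s -> unip (r * s).
Proof.
move=> Ur Us; have [k rk] := unip_nil Ur; apply: (@nil_unip _ k).
by rewrite exprMn_comm ?rk ?mul0r //; apply: unip_comm.
Qed.

Lemma unip_conj c r : c \in G -> unip r -> unip (iota c * r * iota c^-1%g).
Proof.
move=> Gc [p Pp pE]; have Gp := subsetP sPG p Pp; exists (p ^ c^-1)%g.
  by rewrite memJ_norm ?groupV // (subsetP (normal_norm nsPG)).
rewrite conjgE invgK !iotaM ?(groupM, groupV) //.
by rewrite pE mulrA mulrDr mulr1 mulrDl iotaV.
Qed.

(* [(c r)^3] is the product of the three conjugates of [r], which commute. *)
Lemma unip_mull c r : c \in C -> unip r -> unip (iota c * r).
Proof.
move=> Cc Ur; have Gc := subsetP sCG c Cc.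
have c3 : (c ^+ 3 = 1)%g.
  have abelC := complement_abelem.
  by have [_ ->] := abelemP (isT : prime 3) abelC.
pose A := iota c; pose A' := iota c^-1%g.
have AA' : A * A' = 1 by apply: iotaV.
have A'A : A' * A = 1 by rewrite /A /A' -{2}[c]invgK iotaV ?groupV.
have A3 : A * (A * A) = 1.
  by rewrite -[A * _]/(A ^+ 3) -iotaX // c3 iota1.
pose r1 := A * r * A'; pose r2 := A * r1 * A'.
have Ur1 : unip r1 by apply: unip_conj.
have Ur2 : unip r2 by apply: unip_conj.
have cube : (A * r) ^+ 3 = r1 * r2 * r.
  have e1 : A * r = r1 * A by rewrite /r1 -[RHS]mulrA A'A mulr1.
  have e2 : A * r1 = r2 * A by rewrite /r2 -[RHS]mulrA A'A mulr1.
  have A3r : A * (A * (A * r)) = r by rewrite !mulrA -[A * A * A]mulrA A3 mul1r.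
  clearbody r2; clearbody r1.
  transitivity (r1 * A * (r1 * A * (A * r))).
    by rewrite -e1 !exprS expr0 mulr1.
  by rewrite !mulrA -[r1 * A * r1]mulrA e2 -!mulrA A3r.
have [k r1k] := unip_nil Ur1.
(* [2 ^ k.+2 = 3 * 2 ^ k + 2 ^ k], and the power of exponent [3 * 2 ^ k] already vanishes. *)
apply: (@nil_unip _ k.+2); rewrite expnS expnS mulnA.
have -> : (A * r) ^+ (2 * 2 * 2 ^ k) = (A * r) ^+ (3 * 2 ^ k) * (A * r) ^+ (2 ^ k).
  by rewrite -exprD -mulSnr.
have c12 : GRing.comm r1 r2 := unip_comm Ur1 Ur2.
have c12r : GRing.comm (r1 * r2) r := unip_comm (unipM Ur1 Ur2) Ur.
by rewrite exprM cube (exprMn_comm _ c12r) (exprMn_comm _ c12) r1k !mul0r.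
Qed.

(* [(c r) r = r (c r) = (r c) r = r (r c)]. *)
Lemma unip_sqr_central c r : c \in C -> unip r ->
  iota c * (r * r) = r * r * iota c.
Proof.
move=> Cc Ur; have Gc := subsetP sCG c Cc.
have Urc : unip (r * iota c).
  have -> : r * iota c = iota c * (iota c^-1%g * r * iota c).
    by rewrite !mulrA iotaV // mul1r.
  apply: unip_mull => //.
  by have := @unip_conj c^-1%g r; rewrite invgK groupV; apply.
rewrite mulrA (unip_comm (unip_mull Cc Ur) Ur) mulrA.
by rewrite (unip_comm Urc Ur) mulrA.
Qed.

(** The letters stand for the powers of [W] from exponent 0 to 6, when the cube of [1 + W + W ^+ 2]
    is compared with [1 + W ^+ 3 + W ^+ 6]. *)
Lemma char2_cancel_chain (o a b c d e f : R) :
  o + a + b + (b + c + d) + (d + e + f) = o + c + f -> a + e = 0.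
Proof.
rewrite !addrA -(addrA (o + a) b) (char2_addrr R2) addr0.
rewrite -(addrA (o + a + c) d) (char2_addrr R2) addr0.
rewrite (addrC o a) -!addrA (addrCA c e) (addrCA o e) addrA => sum_eq.
by apply: (addIr (o + (c + f))); rewrite sum_eq add0r.
Qed.

Let Z := ('C_P(C))%G.
Let Q := [~: P, C]%G.

Lemma coPC : coprime #|P| #|C|.
Proof. by rewrite (card_Hall sylP) p_part coprimeXl // coprime2n. Qed.

(** The decomposition of an abelian group under a coprime action into fixed points and
    commutators. *)
Lemma comm_cent_dprod : (Z \x Q)%g = P.
Proof.
have nQP : Q \subset P by rewrite /= commg_subl.
have tiQZ : (Z :&: Q = 1)%g.
  apply/trivgP; rewrite -(coprime_abel_cent_TI nPC coPC abP) /= subsetI.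
  by rewrite subsetIr (subset_trans (subsetIl _ _)) ?subsetIr.
have cZP : P \subset 'C(Z)%g by rewrite (sub_abelian_cent2 abP) ?subsetIl.
rewrite dprodE //=; last exact: subset_trans nQP cZP.
have nZQ : Z \subset 'N(Q)%g.
  by rewrite cents_norm // centsC (subset_trans nQP cZP).
rewrite (normC nZQ); apply/eqP; rewrite eqEsubset mul_subG ?subsetIl //=.
rewrite -quotientSK ?commg_norml // (coprime_quotient_cent nQP) //.
- by rewrite subsetI subxx quotient_cents2r.
- exact: commg_normr.
- exact: coPC.
- exact: abelian_sol.
Qed.

Lemma full_dprod : (Z \x (Q <*> C))%g = G /\ (Q ><| C)%g = (Q <*> C)%g.
Proof.
apply: dprod_sdprod defG comm_cent_dprod _ _; first exact: subsetIr.
exact: commg_normr.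
Qed.

(** [iota p * iota p] is 1 plus the square of the nilpotent [1 + iota p], and that square commutes
    with [C] by [unip_sqr_central]. *)
Lemma sqr_cent p : p \in P -> (p ^+ 2)%g \in Z.
Proof.
move=> Pp; rewrite inE groupX //=; apply/centP => c Cc.
have [Gp Gc] := (subsetP sPG p Pp, subsetP sCG c Cc).
apply: iota_inj; rewrite ?(groupM, groupX) // !iotaM ?groupX //.
have -> : iota p * iota p = 1 + (1 + iota p) * (1 + iota p).
  by rewrite (char2_sqrD R2) ?mul1r ?mulr1 // (char2_addK R2).
have sq_central := unip_sqr_central Cc (unip_iota Pp).
by rewrite mulrDl [RHS]mulrDr mul1r mulr1 sq_central.
Qed.

Lemma comm_exponent2 q : q \in Q -> (q ^+ 2 = 1)%g.
Proof.
move=> Qq; have [_ eqP _ tiZQ] := dprodP comm_cent_dprod.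
have Pq : q \in P by rewrite -eqP (subsetP (mulG_subr _ _)).
by apply/set1gP; rewrite -tiZQ inE sqr_cent // groupX.
Qed.

(** The projection onto [Z] followed by cubing extends to [psi]. The unit [1 + W + W ^+ 2] comes
    from [Z], so [psi] cubes it; being a ring map, [psi] also sends it to [1 + W ^+ 3 + W ^+ 6].
    Comparison gives [W + W ^+ 5 = 0]. *)
Lemma cent_exponent4 z : z \in Z -> (z ^+ 4 = 1)%g.
Proof.
move=> Zz; have [defZK _] := full_dprod.
have [nsZG nsKG] := dprod_normal2 defZK.
have [_ eqZK _ tiZK] := dprodP defZK.
have cKZ : (Z \in [complements to Q <*> C in G])%g.
  by rewrite complgC; apply/complP.
have [_ eqKZ] := complP cKZ.
have sZG := normal_sub nsZG.
have rZ g : g \in G -> remgr (Q <*> C)%g Z g \in Z.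
  by move=> Gg; rewrite mem_remgr // eqKZ.
have abZ : abelian Z by apply: abelianS abP; apply: subsetIl.
have [||psi psiE] := extend_endo
    (_ : {in G &, {morph (fun g => remgr (Q <*> C)%g Z g ^+ 3)%g
                     : x y / (x * y)%g}}).
- move=> x y Gx Gy /=; rewrite (remgrM cKZ nsKG) // expgMn //.
  by apply: (centsP abZ); apply: rZ.
- by move=> x Gx; rewrite groupX // (subsetP sZG) ?rZ.
have {}psiE x : x \in Z -> psi (iota x) = iota x ^+ 3.
  move=> Zx; rewrite psiE ?(subsetP sZG) // remgr_id //; last by rewrite setIC.
  by rewrite iotaX // (subsetP sZG).
have [Pz Gz] := (subsetP (subsetIl _ _) z Zz : z \in P, subsetP sZG z Zz).
pose W := iota z; pose u := 1 + W + W * W.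
have Uw : unip (1 + W) by apply: unip_iota.
have cW1 : W * (1 + W) = (1 + W) * W by rewrite mulrDr mulrDl mulr1 mul1r.
have [y Py yE] : unip (W * (1 + W)).
  have [k wk] := unip_nil Uw.
  by apply: (@nil_unip _ k); rewrite exprMn_comm // wk mulr0.
have Zy : y \in Z.
  rewrite inE Py /=; apply/centP=> c Cc.
  have Gc := subsetP sCG c Cc; have Gy := subsetP sPG y Py.
  apply: iota_inj; rewrite ?groupM // !iotaM // yE.
  have cWc : GRing.comm (iota c) W.
    rewrite /GRing.comm -!iotaM //; congr (iota _).
    by case/setIP: Zz => _ /centP/(_ c Cc).
  by apply: esym; apply: commrD (commr1 _) (commrM cWc (commrD (commr1 _) cWc)).
have U2 : (1 + W * (1 + W)) ^+ 2 = 1 + W ^+ 2 + W ^+ 4.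
  rewrite expr2 (char2_sqrD R2) ?mul1r ?mulr1 // mulrDr mulr1 (char2_sqrD R2).
    by rewrite addrA -!expr2 -exprM.
  by rewrite mulrA.
have U3 : (1 + W * (1 + W)) ^+ 3 =
    1 + W + W ^+ 2 + (W ^+ 2 + W ^+ 3 + W ^+ 4) + (W ^+ 4 + W ^+ 5 + W ^+ 6).
  rewrite exprSr U2; have -> : 1 + W * (1 + W) = 1 + W + W ^+ 2.
    by rewrite mulrDr mulr1 addrA -expr2.
  by rewrite !mulrDl mul1r !mulrDr !mulr1 -!exprSr -!exprD.
have := psiE y Zy; rewrite yE rmorphD rmorphM rmorphD rmorph1 /= psiE // U3.
rewrite mulrDr mulr1 -exprD addrA => /esym/char2_cancel_chain WW5.
have W4 : W ^+ 4 = 1.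
  apply: (iota_lreg Gz); rewrite -exprS mulr1.
  exact: esym (char2_add_eq0 R2 WW5).
apply: iota_inj; rewrite ?groupX ?group1 // iotaX // W4.
by rewrite iota1.
Qed.

(** Each projection sends one factor of [(1 + iota w) * (1 + iota b)] to [1 + 1 = 0]. So the unit
    obtained by adding 1 has both images 1, and is 1. *)
Lemma central_factor_annih w b (D : {group gT}) :
    (<[w]> \x D)%g = G -> w \in P -> b \in P -> b \in D ->
  (1 + iota w) * (1 + iota b) = 0.
Proof.
move=> defG' Pw Pb Db.
have [psiA [psiB [psi_w psi_D psi_G]]] : exists psiA psiB : {rmorphism R -> R},
   [/\ {in <[w]>%g, forall x, psiA (iota x) = iota x /\ psiB (iota x) = 1},
       {in D, forall x, psiA (iota x) = 1 /\ psiB (iota x) = iota x}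
     & {in G, forall x, iota x = psiA (iota x) * psiB (iota x)}].
  by apply: (@proj_endos G _ _ id).
have [wA wB] := psi_w w (cycle_id w); have [bA bB] := psi_D b Db.
have [y Py yE] := unipM (unip_iota Pw) (unip_iota Pb).
apply: (addrI 1); rewrite addr0 -yE psi_G ?(subsetP sPG) // yE.
rewrite !(rmorphD, rmorphM) !rmorph1 /= wA wB bA bB.
by rewrite R2 mulr0 mul0r addr0 mulr1.
Qed.

(** If [Z] has exponent at most 2, then [P] is elementary abelian and [w = 1] serves. Otherwise an
    element [w] of order 4 attains the exponent of [Z], so [<[w]>] splits off with a complement
    [Z1], and [H] is [Z1 \x Q]. *)
Lemma full_structure : exists (w : gT) (H D : {group gT}),
  [/\ #[w]%g = 1%N \/ #[w]%g = 4%N, (2.-abelem H)%g, (H ><| C)%g = D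
    & (<[w]> \x D)%g = G].
Proof.
have [_ eqZQ _ _] := dprodP comm_cent_dprod.
have sZP : Z \subset P by apply: subsetIl.
have sQP : Q \subset P by rewrite -eqZQ mulG_subr.
have abM x y : x \in P -> y \in P -> commute x y.
  by move=> Px Py; apply: (centsP abP).
have [Z2 | ] := boolP [forall z in Z, z ^+ 2 == 1]%g.
  exists 1%g, P, G; split; rewrite ?order1; [by left | | by [] | ].
    apply/abelemP=> //; split=> // p; rewrite -eqZQ => /mulsgP[z q Zz Qq ->].
    rewrite expgMn; last first.
      by apply: abM; [apply: (subsetP sZP) | apply: (subsetP sQP)].
    by rewrite (comm_exponent2 Qq) mulg1; apply/eqP/(forall_inP Z2).
  by rewrite (cycle1 gT) dprod1g.
case/forall_inPn=> w Zw w2.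
have ow : #[w]%g = 4%N.
  have : (#[w]%g %| 4)%N by rewrite order_dvdn cent_exponent4.
  move: w2; rewrite -order_dvdn; have := order_gt0 w.
  by case: #[w]%g => [|[|[|[|[|n]]]]] // _ _ /(dvdn_leq (isT : 0 < 4)%N).
have abZ : abelian Z := abelianS sZP abP.
have exZ : #[w]%g = exponent Z.
  apply/eqP; rewrite eqn_dvd dvdn_exponent // ow; apply/exponentP.
  exact: cent_exponent4.
have /splitsP[Z1 /complP[tiwZ1 eqZ]] := abelian_splits Zw exZ abZ.
have sZ1Z : Z1 \subset Z by rewrite -eqZ mulG_subr.
have defZ : (<[w]> \x Z1)%g = Z.
  by rewrite dprodE // (sub_abelian_cent2 abZ) ?cycle_subG.
have defP := comm_cent_dprod; rewrite -defZ -dprodA in defP.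
have [[_ H _ defH] _ _ _] := dprodP defP; rewrite defH in defP.
have [_ eqH _ _] := dprodP defH.
have sHP : H \subset P.
  by have [_ <- _ _] := dprodP defP; rewrite mulG_subr.
have Cw : <[w]>%g \subset 'C(C)%g.
  by rewrite cycle_subG; case/setIP: Zw.
have nHC : C \subset 'N(H)%g.
  rewrite -eqH normsM ?commg_normr // cents_norm // centsC.
  by rewrite (subset_trans sZ1Z) // subsetIr.
have [defG' defD] := dprod_sdprod defG defP Cw nHC.
exists w, H, (H <*> C)%G; split=> //; first by right.
have [Pw Gw] := (subsetP sZP w Zw, subsetP sPG w (subsetP sZP w Zw)).
apply/abelemP=> //; split=> [|h]; first exact: abelianS sHP abP.
rewrite -eqH => /mulsgP[b q Z1b Qq ->].
have Zb := subsetP sZ1Z b Z1b; have Pb := subsetP sZP b Zb.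
rewrite expgMn; last by apply: abM => //; apply: (subsetP sQP).
rewrite (comm_exponent2 Qq) mulg1 expgS expg1.
have Hb : b \in H by rewrite -eqH (subsetP (mulG_subl _ _)).
have Db : (b \in H <*> C)%g by rewrite mem_gen // inE Hb.
apply: (annih_twice Gw (subsetP sPG b Pb)).
  exact: central_factor_annih defG' Pw Pb Db.
(* [b] is central in [H <*> C], since it lies in the abelian group [P] and centralises [C]; also
   [b ^+ 4 = 1]. *)
have defG2 : (<[w * b]> \x (H <*> C))%g = G.
  apply: (dprod_cycleM defG'); last by rewrite ow cent_exponent4.
  rewrite inE Db /= centY inE; apply/andP; split.
    by apply: subsetP Hb; apply: subset_trans sHP (subset_trans abP (centS sHP)).
  by case/setIP: Zb.
exact: central_factor_annih defG2 (groupM Pw Pb) Pb Db.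
Qed.

End TwoPart.
End Complement.
End FullRing.

(** * From internal to external products *)

Section ExternalProducts.
Local Open Scope group_scope.

Variable gT : finGroupType.
Implicit Types (w : gT) (A C D G H K : {group gT}).

(** The action [to] is conjugation by [C], pulled back along the isomorphism from [A] to [C]. *)
Lemma sdprod_isog_sdprod_by (aT : finGroupType) (A : {group aT}) H C D :
    H ><| C = D -> A \isog C ->
  exists to : groupAction A H, D \isog [set: sdprod_by to].
Proof.
case/sdprodP=> _ eqD nHC tiHC /isogP[f injf fA].
have actsC : {acts C, on group H | 'J} by split; rewrite ?astabsJ ?subsetT.
have sA : A \subset f @*^-1 C by rewrite -fA -sub_morphim_pre.
pose to := (<[actsC]> \o f \ sA)%gact.
have actf : {in H & A, morph_act to 'J (idm H) f}.
  move=> h a Hh Aa /=; rewrite /actby Hh -fA mem_morphim //.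
exists to; rewrite isog_sym; apply/isogP; exists (xsdprod_morphism actf).
  by rewrite injm_xsdprodm injm_idm injf /= morphim_idm // fA tiHC.
by rewrite im_xsdprodm morphim_idm // fA eqD.
Qed.

Lemma dprod_isog_setX (aT bT : finGroupType) (A : {group aT}) (B : {group bT})
    (K D G : {group gT}) :
  K \x D = G -> K \isog A -> D \isog B -> G \isog setX A B.
Proof.
move=> defG isoA isoB; apply: isog_dprod defG (setX_dprod A B) _ _.
  exact: isog_trans isoA (isog_setX1 _ _).
exact: isog_trans isoB (isog_set1X _ _).
Qed.

Lemma cycle4_isog w : #[w] = 1%N \/ #[w] = 4 ->
  exists W : {group 'Z_4}, <[w]> \isog W.
Proof.
case=> ow.
  exists 1%G.
  by rewrite isog_cyclic_card ?cycle_cyclic ?cyclic1 // -orderE ow cards1.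
exists [set: 'Z_4]%G.
rewrite isog_cyclic_card ?cycle_cyclic // -orderE ow.
by rewrite [X in cyclic X]Zp_cycle cycle_cyclic cardsT card_ord.
Qed.

End ExternalProducts.

(** * The realizing ring *)

Section SpanRealization.
Local Open Scope ring_scope.

(* Ring axioms, and multiplicativity of the extensions [psi], need only be checked
   on the additive generators [iota x]. *)
Lemma span_realization (gT : finGroupType) (G : {group gT}) (V : zmodType)
    (iota : gT -> V) (mul : V -> V -> V)
    (mulDl : forall u v w, mul (u + v) w = mul u w + mul v w)
    (mulDr : forall u v w, mul u (v + w) = mul u v + mul u w)
    (iota_morph : {in G &, forall x y, iota (x * y)%g = mul (iota x) (iota y)})
    (iota_span : forall Q : V -> Prop, Q 0 ->
      (forall u v, Q u -> Q v -> Q (u + v)) ->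
      (forall x, x \in G -> Q (iota x)) -> forall v, Q v)
    (iota_injG : {in G &, injective iota})
    (iota_units : forall u v, mul u v = iota 1%g -> mul v u = iota 1%g ->
      exists2 x, x \in G & iota x = u)
    (iota_ext : forall phi : {morphism G >-> gT}, (phi @* G)%g \subset G ->
      exists2 psi : V -> V, {morph psi : u v / u + v}
        & {in G, forall x, psi (iota x) = iota (phi x)}) :
  fully_realizable G.
Proof.
case: V => T cT in iota mul mulDl mulDr iota_morph iota_span iota_injG
                     iota_units iota_ext *.
set V := GRing.Zmodule.Pack cT in iota mul mulDl mulDr iota_morph iota_span
  iota_injG iota_units iota_ext *.
have mul0 u : mul 0 u = 0 by apply: (addrI (mul 0 u)); rewrite -mulDl !addr0.
have mulr0 u : mul u 0 = 0 by apply: (addrI (mul u 0)); rewrite -mulDr !addr0.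
have G1 := group1 G.
have mA : associative mul.
  move=> u v w; elim/iota_span: u => [|u1 u2|x Gx]; first by rewrite !mul0.
    by rewrite !mulDl => -> ->.
  elim/iota_span: v => [|v1 v2|y Gy]; first by rewrite mul0 !mulr0 mul0.
    by rewrite !(mulDl, mulDr) => -> ->.
  elim/iota_span: w => [|w1 w2|t Gt]; first by rewrite !mulr0.
    by rewrite !mulDr => -> ->.
  by rewrite -!iota_morph ?groupM // mulgA.
have m1 : left_id (iota 1%g) mul.
  move=> u; elim/iota_span: u => [|u1 u2|x Gx]; rewrite ?mulr0 ?mulDr //.
    by move=> -> ->.
  by rewrite -iota_morph // mul1g.
have m1r : right_id (iota 1%g) mul.
  move=> u; elim/iota_span: u => [|u1 u2|x Gx]; rewrite ?mul0 ?mulDl //.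
    by move=> -> ->.
  by rewrite -iota_morph // mulg1.
have mDl : left_distributive mul +%R by move=> u v w; apply: mulDl.
have mDr : right_distributive mul +%R by move=> u v w; apply: mulDr.
pose rC := GRing.Zmodule_isPzRing.Build V mA m1 m1r mDl mDr.
pose R : pzRingType := HB.pack V rC.
exists R, iota; split.
  split=> // u; split=> [[v [uv vu]] | [x Gx <-]]; first exact: iota_units uv vu.
  exists (iota x^-1%g); split; rewrite /GRing.mul /= -iota_morph ?groupV //.
    by rewrite mulgV.
  by rewrite mulVg.
move=> phi sphiG; have [psi psiD psiE] := iota_ext phi sphiG.
have phiG x : x \in G -> phi x \in G.
  by move=> Gx; rewrite (subsetP sphiG) ?mem_morphim.
have psi0 : psi 0 = 0 by apply: (addrI (psi 0)); rewrite -psiD !addr0.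
have psiB : zmod_morphism (psi : R -> R).
  move=> u v; apply: (addIr (psi v)); rewrite addrNK -psiD.
  by congr (psi _); apply: addrNK.
have psiM : monoid_morphism (psi : R -> R).
  split; first by rewrite psiE ?morph1.
  move=> u v; elim/iota_span: u => [|u1 u2|x Gx].
  - by rewrite mul0r psi0 mul0r.
  - by rewrite mulrDl !psiD mulrDl => -> ->.
  elim/iota_span: v => [|v1 v2|y Gy].
  - by rewrite [_ * 0]mulr0 psi0 [_ * 0]mulr0.
  - by rewrite mulrDr !psiD mulrDr => -> ->.
  rewrite [X in psi X](_ : _ = iota (x * y)%g) ?iota_morph //.
  by rewrite -iota_morph // psiE ?groupM // morphM // iota_morph ?phiG // -!psiE.
pose aC := GRing.isZmodMorphism.Build R R psi psiB.
pose mC := GRing.isMonoidMorphism.Build R R psi psiM.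
pose psiR : {rmorphism R -> R} := HB.pack psi aC mC.
by exists psiR.
Qed.

End SpanRealization.

(** * The additive structure on the Sylow 2-subgroup *)

Section TwistedSum.
Local Open Scope group_scope.

Variables (gT : finGroupType) (P : {group gT}).

Definition squares_in (z : gT) :=
  [/\ abelian P, z \in P, z ^+ 2 = 1
    & {in P, forall x, x ^+ 2 = 1 \/ x ^+ 2 = z}].

Variable z : gT.
Hypothesis Pz : squares_in z.
Implicit Types x y t : subg_of P.

Definition nonsq x := x ^+ 2 != 1.
Definition zsub : subg_of P := subg P z.
Definition twist_add x y := x * y * zsub ^+ (nonsq x && nonsq y).

Lemma subg_mulC x y : x * y = y * x.
Proof.
case: Pz => abP _ _ _; apply: val_inj.
exact: (centsP abP _ (subgP x) _ (subgP y)).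
Qed.

Lemma zsub2 : zsub ^+ 2 = 1.
Proof.
case: Pz => _ zP z2 _; apply: val_inj.
by rewrite -[LHS]/(sgval zsub ^+ 2) subgK.
Qed.

Lemma subg_sqr x : x ^+ 2 = zsub ^+ nonsq x.
Proof.
rewrite /nonsq; case: eqP => //= nx2; case: Pz => _ zP _ sqP; apply: val_inj.
rewrite expg1 -[LHS]/(sgval x ^+ 2) subgK //.
have [x2|//] := sqP _ (subgP x); case: nx2; exact: val_inj.
Qed.

Lemma zsubD (b c : bool) : zsub ^+ b * zsub ^+ c = zsub ^+ (b (+) c).
Proof. by rewrite -expgD; case: b; case: c => //; apply: zsub2. Qed.

Lemma nonsq_zsub b : nonsq (zsub ^+ b) = false.
Proof. by rewrite /nonsq -expgM mulnC expgM zsub2 expg1n eqxx. Qed.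

(** Squaring is an endomorphism of the abelian group [P] with values in [{1, z}], and [nonsq]
    records which value is taken. *)
Lemma nonsqM x y : nonsq (x * y) = nonsq x (+) nonsq y.
Proof.
rewrite {1}/nonsq expgMn; last exact: subg_mulC.
have zs t : nonsq t -> zsub != 1.
  by move=> nt; have := nt; rewrite {1}/nonsq subg_sqr nt.
rewrite !subg_sqr zsubD; case E: (_ (+) _); last by rewrite eqxx.
by move: E; rewrite expg1; case: (boolP (nonsq x)) => [/zs->|_ /= /zs->].
Qed.

Lemma nonsqD x y : nonsq (twist_add x y) = nonsq x (+) nonsq y.
Proof. by rewrite /twist_add !nonsqM nonsq_zsub addbF. Qed.

Lemma twist_addC x y : twist_add x y = twist_add y x.
Proof. by rewrite /twist_add andbC [x * y]subg_mulC. Qed.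

(** As [nonsq] is additive, both sides are [x * y * t] times [zsub] to the sum of the three pairwise
    products of the [nonsq] values. *)
Lemma twist_addA x y t : twist_add x (twist_add y t) = twist_add (twist_add x y) t.
Proof.
rewrite {1}/twist_add {3}/twist_add !nonsqD /twist_add -!mulgA.
rewrite [_ ^+ (nonsq x && nonsq y) * _]subg_mulC -!mulgA !zsubD.
by case: (nonsq x); case: (nonsq y); case: (nonsq t).
Qed.

Lemma twist_add1 x : twist_add 1 x = x.
Proof. by rewrite /twist_add {1}/nonsq expg1n eqxx mulg1 mul1g. Qed.

Lemma twist_addxx x : twist_add x x = 1.
Proof. by rewrite /twist_add andbb -[x * x]/(x ^+ 2) subg_sqr zsubD addbb. Qed.

(** The proof of [squares_in z] is a parameter of the type because the additive laws depend on
    it. *)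
Definition twisted of squares_in z : Type := subg_of P.

End TwistedSum.

HB.instance Definition _ gT (P : {group gT}) z (Pz : squares_in P z) :=
  Finite.copy (twisted Pz) (subg_of P).
HB.instance Definition _ gT (P : {group gT}) z (Pz : squares_in P z) :=
  GRing.isZmodule.Build (twisted Pz)
    (twist_addA Pz) (twist_addC Pz) (twist_add1 z) (twist_addxx Pz).

Section TwistedTheory.
Local Open Scope ring_scope.

Variables (gT : finGroupType) (P : {group gT}) (z : gT).
Hypothesis Pz : squares_in P z.
Local Notation N := (twisted Pz).
Implicit Types n m : N.

(** A symmetric biadditive form measuring how far the group product is from the sum, see
    [mulg_twisted]. It serves as the multiplication of [N] in the realizing ring. *)
Definition cross n m : N := (zsub P z : N) *+ (nonsq n && nonsq m).

Lemma twisted_addrr n : n + n = 0.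
Proof. exact: (twist_addxx Pz). Qed.

Lemma zsub_mulrn (b : bool) : (zsub P z : N) *+ b = (zsub P z ^+ b)%g.
Proof. by case: b. Qed.

Lemma mulg_twisted (x y : N) : (x * y)%g = x + y + cross x y :> N.
Proof.
rewrite /cross zsub_mulrn /GRing.add /= /twist_add (nonsqM Pz).
rewrite (nonsq_zsub Pz) andbF expg0 mulg1 -mulgA (zsubD Pz).
by rewrite addbb expg0 mulg1.
Qed.

Lemma nonsq_add n m : nonsq (n + m) = nonsq n (+) nonsq m.
Proof. exact: (nonsqD Pz). Qed.

Lemma twisted_mulrn n k : n *+ k = n *+ odd k.
Proof.
elim: k => // k IHk; rewrite mulrS IHk /=.
by case: (odd k); rewrite ?addr0 // twisted_addrr.
Qed.

Lemma crossDl n n' m : cross (n + n') m = cross n m + cross n' m.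
Proof.
rewrite /cross nonsq_add -mulrnDr [RHS]twisted_mulrn; congr (_ *+ _).
by case: (nonsq n); case: (nonsq n'); case: (nonsq m).
Qed.

Lemma crossC n m : cross n m = cross m n.
Proof. by rewrite /cross andbC. Qed.

Lemma crossDr n m m' : cross n (m + m') = cross n m + cross n m'.
Proof. by rewrite !(crossC n) crossDl. Qed.

Definition lift_endo (f : gT -> gT) n : N := subg P (f (sgval n)).

(** The correction term must be respected. If [x] and [y] have nontrivial squares, both squares are
    [z], so [F z] is the square of [F x] and of [F y]: either both images have square [z] and [F]
    fixes [z], or both squares and [F z] are trivial. *)
Lemma lift_endoD (f : gT -> gT) :
    {in P &, {morph f : x y / (x * y)%g}} -> {in P, forall x, f x \in P} ->
  {morph lift_endo f : n m / n + m}.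
Proof.
move=> fM fP.
pose F (x : subg_of P) : subg_of P := subg P (f (sgval x)).
have FM x y : F (x * y)%g = (F x * F y)%g.
  by rewrite /F -morphM ?fP ?subgP //= fM ?subgP.
have F1 : F 1%g = 1%g by apply: (mulgI (F 1%g)); rewrite -FM !mulg1.
have FX x k : F (x ^+ k)%g = (F x ^+ k)%g.
  by elim: k => [|k IHk]; rewrite ?F1 // !expgS FM IHk.
have nsF x : nonsq (F x) -> nonsq x.
  by apply: contraNN => /eqP x2; rewrite -FX x2 F1.
move=> x y; rewrite /lift_endo -/(F _) -/(F x) -/(F y).
rewrite /GRing.add /= /twist_add !FM FX; congr (_ * _ * _)%g.
have [nx|nnx] := boolP (nonsq x); last first.
  by rewrite (negbTE (contra (@nsF x) nnx)).
have [ny|nny] := boolP (nonsq y); last first.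
  by rewrite (negbTE (contra (@nsF y) nny)) !andbF.
have Fz t : nonsq t -> F (zsub P z) = (zsub P z ^+ nonsq (F t))%g.
  by move=> nt; rewrite -(subg_sqr Pz) -FX (subg_sqr Pz) nt expg1.
rewrite /= expg1 (Fz x nx).
have : (zsub P z ^+ nonsq (F x) = zsub P z ^+ nonsq (F y))%g.
  by rewrite -!Fz.
case nFx: (nonsq (F x)); case nFy: (nonsq (F y)) => //=.
Qed.

End TwistedTheory.

(** * The group algebra over the field with two elements *)

Section GroupAlgebraF2.
Local Open Scope ring_scope.

Variable cT : finGroupType.
Local Notation A := {ffun cT -> 'F_2}.
Implicit Types a b : A.

Definition delta (c : cT) : A := [ffun x => (x == c)%:R].
Definition conv a b : A := [ffun x => \sum_d a d * b (d^-1 * x)%g].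
Definition aug a : 'F_2 := \sum_c a c.

Lemma F2_cases (x : 'F_2) : x = 0 \/ x = 1.
Proof. by case: x => [[|[|//]] ltx]; [left | right]; apply: val_inj. Qed.

(** Here [x] and [y] are read as natural numbers, so additivity in the scalar holds only because 2
    kills [v]. *)
Lemma mulrn_F2D (V : zmodType) (v : V) (x y : 'F_2) :
  v + v = 0 -> v *+ (x + y)%R = v *+ x + v *+ y.
Proof.
by move=> vv; case: (F2_cases x) => ->; case: (F2_cases y) => ->;
  rewrite ?(add0r, addr0) //= vv.
Qed.

Lemma convDl a b c : conv (a + b) c = conv a c + conv b c.
Proof.
apply/ffunP=> x; rewrite !ffunE -big_split; apply: eq_bigr => d _ /=.
by rewrite ffunE mulrDl.
Qed.

Lemma convDr a b c : conv a (b + c) = conv a b + conv a c.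
Proof.
apply/ffunP=> x; rewrite !ffunE -big_split; apply: eq_bigr => d _ /=.
by rewrite ffunE mulrDr.
Qed.

Lemma conv_delta c d : conv (delta c) (delta d) = delta (c * d)%g.
Proof.
apply/ffunP=> x; rewrite !ffunE (bigD1 c) //= big1 => [|e /negbTE nec].
  by rewrite !ffunE eqxx mul1r addr0 -(inj_eq (mulgI c)) mulKVg.
by rewrite ffunE nec mul0r.
Qed.

Lemma augD a b : aug (a + b) = aug a + aug b.
Proof. by rewrite /aug -big_split; apply: eq_bigr => c _; rewrite ffunE. Qed.

Lemma sum_delta (V : zmodType) (F : cT -> V) c :
  \sum_d F d *+ delta c d = F c.
Proof.
rewrite (bigD1 c) //= ffunE eqxx mulr1n big1 ?addr0 // => d /negbTE ndc.
by rewrite ffunE ndc mulr0n.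
Qed.

Lemma aug_delta c : aug (delta c) = 1.
Proof.
rewrite /aug (bigD1 c) //= ffunE eqxx big1 ?addr0 // => d /negbTE ndc.
by rewrite ffunE ndc.
Qed.

Lemma aug_conv a b : aug (conv a b) = aug a * aug b.
Proof.
rewrite /aug mulr_suml (eq_bigr (fun x => \sum_d a d * b (d^-1 * x)%g)).
  rewrite exchange_big; apply: eq_bigr => d _ /=.
  by rewrite -mulr_sumr (reindex_inj (mulgI d)) /=; congr (_ * _);
    apply: eq_bigr => c _; rewrite mulKg.
by move=> x _; rewrite ffunE.
Qed.

Lemma delta_span a : a = \sum_c delta c *+ a c.
Proof.
apply/ffunP=> x; rewrite sum_ffunE (bigD1 x) //= big1 => [|c ncx].
  rewrite addr0; case: (F2_cases (a x)) => ->; rewrite ?mulr0n ?mulr1n ffunE //.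
  by rewrite eqxx.
case: (F2_cases (a c)) => ->; rewrite ?mulr0n ?mulr1n ffunE //.
by rewrite eq_sym (negbTE ncx).
Qed.

(* A unit has odd support; full support of size three would make it the sum of
   all group elements, whose multiples are constant. *)
Lemma conv_unit a b : #|cT| = 1%N \/ #|cT| = 3 -> conv a b = delta 1%g ->
  exists c, a = delta c.
Proof.
move=> ocT ab1.
have aug_a : aug a = 1.
  have := aug_delta 1%g; rewrite -ab1 aug_conv.
  by case: (F2_cases (aug a)) => -> //; rewrite mul0r.
pose S := [set c | a c != 0].
have aS c : a c = (c \in S)%:R.
  by rewrite inE; case: (F2_cases (a c)) => ->.
have oddS : odd #|S|.
  have : (#|S|)%:R = 1 :> 'F_2.
    rewrite -sum1_card natr_sum big_mkcond -aug_a; apply: eq_bigr => c _.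
    by rewrite aS; case: (c \in S).
  move/(congr1 val) => /=; rewrite val_Fp_nat // modn2.
  by case: (odd _).
have leS : (#|S| <= #|cT|)%N by apply: max_card.
have [/cards1P[c Sc] | nS1] := boolP (#|S| == 1)%N.
  by exists c; apply/ffunP=> x; rewrite aS Sc ffunE inE.
have oT : #|cT| = 3%N.
  by case: ocT => // o1; move: nS1 oddS leS; rewrite o1; case: #|S| => [|[|]].
have fullS : S = setT.
  apply/eqP; rewrite eqEcard subsetT cardsT oT.
  by move: nS1 oddS; case: #|S| => [|[|[|]]].
have [c ntc] : exists c : cT, c != 1%g.
  have : ([set: cT] != 1)%g by rewrite trivg_card1 cardsT oT.
  by case/trivgPn=> c _ ntc; exists c.
have conv_const x : conv a b x = aug b.
  rewrite ffunE /aug; rewrite (reindex_inj invg_inj) /=.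
  rewrite (reindex_inj (mulIg x^-1%g)) /=; apply: eq_bigr => d _.
  by rewrite aS fullS inE mul1r invgK mulgKV.
have := conv_const c; rewrite -(conv_const 1%g) ab1 !ffunE eqxx (negbTE ntc).
by move/eqP.
Qed.

End GroupAlgebraF2.

(** * The ring structure on the group algebra of [C] plus [N] *)

Section Realization.
Local Open Scope ring_scope.

Variables (gT : finGroupType) (G P C : {group gT}) (z : gT).
Hypothesis sylP : (2.-Sylow(G) P)%g.
Hypothesis Pz : squares_in P z.
Hypothesis defG : (P ><| C)%g = G.
Hypothesis oC : #|C| = 1%N \/ #|C| = 3.

Local Notation N := (twisted Pz).
Local Notation A := {ffun subg_of C -> 'F_2}.
Local Notation V := (A * N)%type.
Implicit Types (u v w : V) (n m : N).

Let eqPC : (P * C)%g = G. Proof. by case/sdprodP: defG. Qed.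
Let tiPC : P :&: C = 1%g. Proof. by case/sdprodP: defG. Qed.
Let nPC : (C \subset 'N(P))%g. Proof. by case/sdprodP: defG. Qed.
Let nsPG : (P <| G)%g. Proof. by case/sdprod_context: defG. Qed.
Let sPG : P \subset G. Proof. exact: normal_sub. Qed.
Let sCG : C \subset G. Proof. by rewrite -eqPC mulG_subr. Qed.

(** The inverse makes this the left action, sending [x] to [c x c^-1]. *)
Definition conjN (c : subg_of C) : N -> N :=
  @lift_endo _ _ _ Pz (fun x => x ^ (sgval c)^-1)%g.

Lemma conjND c : {morph conjN c : n m / n + m}.
Proof.
apply: lift_endoD => [x y _ _|x Px] /=; first exact: conjMg.
by rewrite memJ_norm // groupV (subsetP nPC) ?subgP.
Qed.

Definition act (a : A) n : N := \sum_c conjN c n *+ a c.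

(** [N] is an ideal on which [C] acts by conjugation from the left and trivially from the right;
    hence the augmentation in the second term. *)
Definition realM u v : V :=
  (conv u.1 v.1, act u.1 v.2 + u.2 *+ aug v.1 + cross u.2 v.2).

Lemma actDr a n m : act a (n + m) = act a n + act a m.
Proof.
by rewrite /act -big_split; apply: eq_bigr => c _; rewrite conjND mulrnDl.
Qed.

Lemma actDl a b n : act (a + b) n = act a n + act b n.
Proof.
rewrite /act -big_split; apply: eq_bigr => c _.
by rewrite ffunE mulrn_F2D // twisted_addrr.
Qed.

Lemma realMDl u v w : realM (u + v) w = realM u w + realM v w.
Proof.
congr (_, _); rewrite /= ?convDl // actDl crossDl mulrnDl.
by rewrite [RHS]addrACA; congr (_ + _); apply: addrACA.
Qed.

Lemma realMDr u v w : realM u (v + w) = realM u v + realM u w.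
Proof.
congr (_, _); rewrite /= ?convDr // actDr crossDr augD.
rewrite mulrn_F2D ?twisted_addrr //.
by rewrite [RHS]addrACA; congr (_ + _); apply: addrACA.
Qed.

Definition embed (x : gT) : V :=
  (delta (subg C (remgr P C x)), subg P (divgr P C x) : N).

Lemma embed_mulg x c : x \in P -> c \in C ->
  embed (x * c)%g = (delta (subg C c), subg P x : N).
Proof. by move=> Px Cc; rewrite /embed remgrMid // divgrMid. Qed.

Lemma embed_P x : x \in P -> embed x = (delta 1%g, subg P x : N).
Proof.
move=> Px; rewrite -[x in LHS]mulg1 embed_mulg // ?group1 //.
by congr (delta _, _); apply: val_inj; rewrite /= subgK.
Qed.

Lemma embed_C c : c \in C -> embed c = (delta (subg C c), 0).
Proof.
move=> Cc; rewrite -[c in LHS]mul1g embed_mulg ?group1 //.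
by congr (_, _); apply: val_inj; rewrite /= subgK.
Qed.

Lemma embedP x : x \in G -> exists p c,
  [/\ p \in P, c \in C & x = (p * c)%g].
Proof. by rewrite -eqPC => /mulsgP[p c Pp Cc ->]; exists p, c. Qed.

Lemma nonsqE (x : gT) : x \in P -> nonsq (subg P x) = (x ^+ 2 != 1)%g.
Proof. by move=> Px; rewrite /nonsq -val_eqE /= subgK. Qed.

Lemma nonsqJ x c : x \in P -> c \in G ->
  nonsq (subg P (x ^ c)%g) = nonsq (subg P x).
Proof.
move=> Px Gc; rewrite !nonsqE // -?conjXg ?conjg_eq1 //.
by rewrite memJ_norm // (subsetP (normal_norm nsPG)).
Qed.

(** In [p c q d = p q^(c^-1) c d] the product of the two elements of [P] is their sum plus [cross],
    and [cross] ignores the conjugation by [nonsqJ]. *)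
Lemma embedM : {in G &, forall x y, embed (x * y)%g = realM (embed x) (embed y)}.
Proof.
move=> _ _ /embedP[p [c [Pp Cc ->]]] /embedP[q [d [Pq Cd ->]]].
have Pqc : (q ^ c^-1)%g \in P.
  by rewrite memJ_norm // groupV (subsetP nPC).
have -> : (p * c * (q * d) = p * q ^ c^-1 * (c * d))%g.
  by rewrite conjgE invgK !mulgA mulgKV.
have Ppq : (p * q ^ c^-1)%g \in P := groupM Pp Pqc.
rewrite (embed_mulg Ppq (groupM Cc Cd)) !embed_mulg // /realM /=; congr (_, _).
  by rewrite conv_delta subgM.
rewrite aug_delta /act sum_delta mulr1n (subgM Pp Pqc) [LHS](@mulg_twisted _ _ _ Pz).
have -> : conjN (subg C c) (subg P q : N) = subg P (q ^ c^-1)%g :> N.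
  by rewrite /conjN /lift_endo !subgK.
rewrite [X in X + _]addrC; congr (_ + _).
rewrite /cross; congr (_ *+ (_ && _)).
by rewrite nonsqJ // groupV (subsetP sCG).
Qed.

Lemma embed_span (Q : V -> Prop) : Q 0 ->
  (forall u v, Q u -> Q v -> Q (u + v)) -> (forall x, x \in G -> Q (embed x)) ->
  forall v, Q v.
Proof.
move=> Q0 QD Qe [a n].
have QX v k : Q v -> Q (v *+ k).
  by move=> Qv; elim: k => [|k IHk]; rewrite ?mulrS; auto.
have -> : (a, n) = (a, 0) + (0, n) :> V by congr (_, _); rewrite ?addr0 ?add0r.
apply: (QD).
  rewrite (delta_span a).
  apply: (big_ind (fun a => Q (a, 0))) => // [b b' Qb Qb'|c _].
    have -> : (b + b', 0) = (b, 0) + (b', 0) :> V by congr (_, _); rewrite addr0.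
    exact: (QD).
  have -> : (delta c *+ a c, 0) = embed (sgval c) *+ a c :> V.
    rewrite embed_C ?subgP // sgvalK.
    by case: (F2_cases (a c)) => ->; rewrite ?mulr0n ?mulr1n.
  by apply/QX/Qe; rewrite (subsetP sCG) ?subgP.
(* Both images have first component [delta 1], and these cancel since 2 = 0. *)
have -> : (0, n) = embed (sgval n) + embed 1%g :> V.
  rewrite embed_P ?subgP // embed_C ?group1 // sgvalK.
  have -> : subg C 1%g = 1%g by apply: val_inj; rewrite /= subgK.
  congr (_, _); rewrite /= ?addr0 //.
  by apply/ffunP=> x; rewrite !ffunE; case: (_ == _); apply: val_inj.
by apply: QD; apply: Qe; rewrite ?group1 // (subsetP sPG) ?subgP.
Qed.

Lemma embed_inj : {in G &, injective embed}.
Proof.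
move=> _ _ /embedP[p [c [Pp Cc ->]]] /embedP[q [d [Pq Cd ->]]].
rewrite !embed_mulg // => -[/ffunP/(_ (subg C c))].
rewrite !ffunE eqxx; case: eqP => // /(congr1 val) /=.
rewrite !subgK // => -> _ /(congr1 (@sgval _ _)).
by rewrite !subgK // => ->.
Qed.

(** A unit projects to a unit of the group algebra, which is some [delta c] by [conv_unit]. The
    component in [N] is unrestricted: [(delta c, n)] is the image of [n c]. *)
Lemma embed_units u v : realM u v = embed 1%g -> realM v u = embed 1%g ->
  exists2 x, x \in G & embed x = u.
Proof.
move=> uv _; have oC' : #|subg_of C| = 1%N \/ #|subg_of C| = 3.
  by rewrite -cardsT -(card_isog (isog_subg C)).
have [c uc] : exists c, u.1 = delta c.
  apply: (@conv_unit _ u.1 v.1 oC').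
  by move/(congr1 fst): uv; rewrite embed_P ?group1.
exists (sgval (u.2 : subg_of P) * sgval c)%g.
  by rewrite -eqPC mem_mulg ?subgP.
by rewrite embed_mulg ?subgP // !sgvalK -uc; case: (u).
Qed.

Lemma morph_P (phi : {morphism G >-> gT}) x :
  (phi @* G)%g \subset G -> x \in P -> phi x \in P.
Proof.
move=> sphi Px; have Gx := subsetP sPG x Px.
have Gphi : phi x \in G by rewrite (subsetP sphi) ?mem_morphim.
rewrite (mem_normal_Hall sylP nsPG Gphi) morph_p_elt //.
exact: mem_p_elt (pHall_pgroup sylP) Px.
Qed.

(* If [(q c)^3 = c^3 = 1] then [q] times two of its conjugates is [1]; all three
   have the same square. *)
Lemma coset_cube q c : q \in P -> c \in C -> ((q * c) ^+ 3 = 1)%g ->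
  (c ^+ 3 = 1)%g -> (q ^+ 2 = 1)%g.
Proof.
move=> Pq Cc qc3 c3; have [abP zP z2 sqP] := Pz.
have Pconj d : d \in C -> (q ^ d)%g \in P.
  by move=> Cd; rewrite memJ_norm // (subsetP nPC).
have Cc' : c^-1%g \in C by rewrite groupV.
have Cc2 : (c ^- 2)%g \in C by rewrite groupV groupX.
have prod1 : (q * q ^ c^-1 * q ^ (c ^- 2) = 1)%g.
  have c2 : (c ^- 2 = c)%g by apply/eqP; rewrite eq_invg_mul -expgSr c3.
  rewrite c2 -qc3 !conjgE invgK !mulgA -(mulgA _ c^-1 c^-1)%g -invMg.
  by rewrite -[(c * c)%g]/(c ^+ 2)%g c2 !expgS expg0 mulg1 !mulgA.
(* A conjugate of a nontrivial square is again a nontrivial square in [P], and [z] is the only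
   one. *)
have sqJ d : d \in C -> ((q ^ d) ^+ 2 = q ^+ 2)%g.
  move=> Cd; rewrite -conjXg; have := sqP _ (Pconj d Cd); rewrite -conjXg.
  case=> [/eqP|]; first by rewrite conjg_eq1 => /eqP->; rewrite conj1g.
  move=> qd; have [q1|q2] := sqP q Pq; last by rewrite qd q2.
  by rewrite q1 conj1g.
have q4 : (q ^+ 2 * q ^+ 2 = 1)%g.
  by have [->|->] := sqP q Pq; rewrite ?mulg1 // -z2.
have := congr1 (fun x => x ^+ 2)%g prod1.
have [Pq1 Pq2] := (Pconj _ Cc', Pconj _ Cc2).
rewrite expg1n expgMn; last by apply: (centsP abP) => //; apply: groupM.
rewrite expgMn; last exact: (centsP abP).
by rewrite !sqJ // q4 mul1g.
Qed.

(** [psi] is prescribed by [phi] on the basis [delta c] and on [N]. On [p c] it is correct because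
    [phi c = q d] with [q ^+ 2 = 1], so that [cross] of [phi p] and [q] vanishes. *)
Lemma embed_ext (phi : {morphism G >-> gT}) : (phi @* G)%g \subset G ->
  exists2 psi : V -> V, {morph psi : u v / u + v}
    & {in G, forall x, psi (embed x) = embed (phi x)}.
Proof.
move=> sphi; have phiP x : x \in P -> phi x \in P by apply: morph_P.
pose phiN : N -> N := @lift_endo _ _ _ Pz phi.
have phiND : {morph phiN : n m / n + m}.
  apply: lift_endoD => // x y Px Py.
  by rewrite morphM ?(subsetP sPG).
pose psi u : V := \sum_c embed (phi (sgval c)) *+ u.1 c + (0, phiN u.2).
have VV v : v + v = 0.
  case: v => a n; congr (_, _); last exact: twisted_addrr.
  by apply/ffunP=> c; rewrite !ffunE; case: (F2_cases (a c)) => ->; apply: val_inj.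
exists psi => [u v | _ /embedP[p [c [Pp Cc ->]]]].
  rewrite /psi addrACA; congr (_ + _).
    rewrite -big_split; apply: eq_bigr => c _ /=.
    by rewrite ffunE mulrn_F2D.
  by congr (_, _); rewrite /= ?addr0 // phiND.
have [Gp Gc] := (subsetP sPG p Pp, subsetP sCG c Cc).
have [Gphip Gphic] : phi p \in G /\ phi c \in G.
  by split; rewrite (subsetP sphi) ?mem_morphim.
rewrite morphM // embedM // embed_mulg // /psi /= sum_delta subgK //.
have [q [d [Pq Cd phic]]] := embedP Gphic.
have c3 x : x \in C -> (x ^+ 3 = 1)%g.
  move=> Cx; apply/eqP; rewrite -order_dvdn.
  apply: dvdn_trans (order_dvdG Cx) _.
  by case: oC => ->.
have q2 : (q ^+ 2 = 1)%g.
  apply: (coset_cube Pq Cd); last exact: c3.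
  by rewrite -phic -morphX // c3 // morph1.
rewrite phic embed_mulg // (embed_P (phiP p Pp)) /realM /=.
congr (_, _); rewrite /= ?addr0.
  by rewrite conv_delta mul1g.
rewrite aug_delta mulr1n /act sum_delta /cross [nonsq (subg P q)]nonsqE //.
rewrite q2 eqxx andbF mulr0n addr0; congr (_ + _).
  by rewrite /conjN /lift_endo subgK //= invg1 conjg1.
by rewrite /phiN /lift_endo subgK.
Qed.

Theorem split_realization : fully_realizable G.
Proof.
exact: span_realization realMDl realMDr embedM embed_span embed_inj embed_units
  embed_ext.
Qed.

End Realization.

(** * The two implications *)

Local Open Scope group_scope.

Lemma full_necessity (gT : finGroupType) (G P : {group gT}) :
    2.-Sylow(G) P -> abelian P -> P <| G -> fully_realizable G ->
  (exists (W : {group 'Z_4}) (hT : finGroupType) (H : {group hT})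
          (to : groupAction [set: 'Z_3] H),
      2.-abelem H /\ G \isog setX W [set: sdprod_by to])
  \/
  (exists (W : {group 'Z_4}) (hT : finGroupType) (H : {group hT}),
      2.-abelem H /\ G \isog setX W H).
Proof.
move=> sylP abP nP [R [iota [isoU full]]].
have /splitsP[C /complP[tiPC eqPC]] := SchurZassenhaus_split (pHall_Hall sylP) nP.
have sCG : C \subset G by rewrite -eqPC mulG_subr.
have defG : P ><| C = G by rewrite sdprodE // (subset_trans sCG) ?normal_norm.
have oddC : odd #|C|.
  have : #|G : P| = #|C|.
    by rewrite -divgS ?normal_sub // -(sdprod_card defG) mulKn.
  by rewrite odd_2'nat => <-; case/and3P: sylP.
have [w [H [D [ow abelH defD defG']]]] := full_structure isoU full defG oddC sylP abP.
have [W isoW] := cycle4_isog ow.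
case: (card_complement isoU full defG oddC) => oC.
  right; exists W, gT, H; split=> //; apply: dprod_isog_setX defG' isoW _.
  by rewrite -defD (card1_trivg oC) sdprodg1 isog_refl.
left; have isoC : [set: 'Z_3] \isog C.
  have cyc3 : cyclic [set: 'Z_3] by rewrite Zp_cycle cycle_cyclic.
  by rewrite isog_cyclic_card // prime_cyclic oC // cardsT card_ord.
have [to isoD] := sdprod_isog_sdprod_by defD isoC.
by exists W, gT, H, to; split=> //; apply: dprod_isog_setX defG' isoW isoD.
Qed.

(** The group law is addition modulo 4, so the squares are 0 and 2. *)
Lemma Z4_squares (u v : 'Z_4) :
  u ^+ 2 * u ^+ 2 = 1 /\ (u ^+ 2 != 1 -> v ^+ 2 = 1 \/ v ^+ 2 = u ^+ 2).
Proof.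
case: u => [[|[|[|[|//]]]] ltu]; case: v => [[|[|[|[|//]]]] ltv];
  (split; first exact: val_inj); move=> // _;
  by [left; apply: val_inj | right; apply: val_inj].
Qed.

(** The 2-elements of [D] lie in [H] and square to 1, so squares in [P] are seen in [W] alone and at
    most one is nontrivial. The cases [#|K| = 1] and [#|K| = 3] cover both shapes of [G]. *)
Lemma setX_sdprod_realizable (gT dT : finGroupType) (G P : {group gT})
    (W : {group 'Z_4}) (D H K : {group dT}) :
    2.-Sylow(G) P -> abelian P -> P <| G -> G \isog setX W D ->
    H ><| K = D -> 2.-abelem H -> #|K| = 1%N \/ #|K| = 3 ->
  fully_realizable G.
Proof.
move=> sylP abP nP isoG defD abelH oK.
have oddK : 2^'.-nat #|K| by case: oK => ->.
have cardD : (#|H| * #|K|)%N = #|D| := sdprod_card defD.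
have pH : 2.-nat #|H| by case/and3P: abelH.
have nsHD : H <| D by case/sdprod_context: defD.
have sylH : 2.-Sylow(D) H.
  rewrite pHallE normal_sub //= -cardD partnM ?cardG_gt0 //.
  by rewrite part_pnat_id // part_p'nat // muln1.
have sq_D d : d \in D -> 2.-elt d -> d ^+ 2 = 1.
  move=> Dd; rewrite -(mem_normal_Hall sylH nsHD Dd).
  by have [_ exH] := abelemP (isT : prime 2) abelH; apply: exH.
have snd_expg (a : 'Z_4 * dT) n : (a ^+ n).2 = a.2 ^+ n.
  by elim: n => // n IHn; rewrite !expgS -IHn.
case/isogP: isoG => f injf fG.
have sPG := normal_sub nP.
have fP x : x \in P -> f x \in setX W D /\ (f x).2 ^+ 2 = 1.
  move=> Px; have Gx := subsetP sPG x Px.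
  have Xfx : f x \in setX W D by rewrite -fG mem_morphim.
  split=> //; have /setXP[_ Dfx] : ((f x).1, (f x).2) \in setX W D.
    by rewrite -surjective_pairing.
  apply: sq_D => //; apply: pnat_dvd (mem_p_elt (pHall_pgroup sylP) Px).
  rewrite order_dvdn -snd_expg -morphX // expg_order morph1 //.
have fP2 x : x \in P -> f (x ^+ 2) = ((f x).1 ^+ 2, 1).
  move=> Px; have Gx := subsetP sPG x Px; have [_ fx2] := fP x Px.
  rewrite morphX // -fx2 [in LHS](surjective_pairing (f x)).
  by [].
have [z Pz] : exists z, squares_in P z.
  (* [z] is 1 when all squares are trivial, and otherwise any nontrivial square. *)
  have [/forall_inP sq1 | ] := boolP [forall x in P, x ^+ 2 == 1].
    exists 1; split; rewrite ?group1 ?expg1n // => x Px.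
    by left; apply/eqP/sq1.
  case/forall_inPn=> x Px x2; exists (x ^+ 2).
  have finj a b : a \in P -> b \in P -> f a = f b -> a = b.
    by move=> Pa Pb; apply: (injmP injf); apply: (subsetP sPG).
  have [Px2 P1] := (groupX 2 Px, group1 P).
  have u2 : (f x).1 ^+ 2 != 1.
    apply: contra x2 => /eqP u2; apply/eqP/finj => //.
    by rewrite fP2 // u2 morph1.
  split=> // [|y Py].
    apply: finj; rewrite ?groupX // morph1 expgS expg1 morphM ?(subsetP sPG) //.
    by rewrite fP2 //; congr (_, _); [case: (Z4_squares (f x).1 1) | rewrite mulg1].
  have [_ /(_ u2)[v2|v2]] := Z4_squares (f x).1 (f y).1; [left | right].
    by apply: finj; rewrite ?groupX // fP2 // v2 morph1.
  by apply: finj; rewrite ?groupX // !fP2 // v2.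
have /splitsP[C /complP[tiPC eqPC]] := SchurZassenhaus_split (pHall_Hall sylP) nP.
have sCG : C \subset G by rewrite -eqPC mulG_subr.
have defG : P ><| C = G by rewrite sdprodE // (subset_trans sCG) ?normal_norm.
(* Both are the odd part of [#|G|], as [P], [W] and [H] are 2-groups. *)
have oC : #|C| = #|K|.
  have cardG : #|G| = (#|W| * #|D|)%N by rewrite -(card_injm injf) // fG cardsX.
  have pW : 2.-nat #|W|.
    apply: pnat_dvd (cardSg (subsetT W)) _.
    by rewrite /= cardsT card_ord.
  have p'C : 2^'.-nat #|C|.
    have <- : #|G : P| = #|C| by rewrite -divgS // -(sdprod_card defG) mulKn.
    by case/and3P: sylP.
  have := congr1 (partn^~ 2^') (sdprod_card defG).
  rewrite cardG -cardD /= !partnM ?muln_gt0 ?cardG_gt0 //.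
  have triv n : 2.-nat n -> partn n 2^' = 1%N.
    by move=> n2; apply: part_p'nat; rewrite pnatNK.
  rewrite (triv _ (pHall_pgroup sylP)) (triv _ pW) (triv _ pH).
  by rewrite !mul1n !part_pnat_id.
by apply: split_realization sylP Pz defG _; rewrite oC.
Qed.

Lemma sdprod_by_realizable (gT hT : finGroupType) (G P : {group gT})
    (W : {group 'Z_4}) (H : {group hT}) (to : groupAction [set: 'Z_3] H) :
    2.-Sylow(G) P -> abelian P -> P <| G -> 2.-abelem H ->
    G \isog setX W [set: sdprod_by to] ->
  fully_realizable G.
Proof.
move=> sylP abP nP abelH isoG.
apply: setX_sdprod_realizable sylP abP nP isoG (sdprod_sdpair to) _ _.
  exact: morphim_abelem.
by right; rewrite card_injm ?injm_sdpair2 // cardsT card_ord.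
Qed.

Unset Implicit Arguments.

(* The second alternative covers the 2-groups (no C_3 factor): without it the
   equivalence fails already for the trivial group, the unit group of F_2. *)
Theorem theorem10p9 (gT : finGroupType) (G P : {group gT})
    (sylP : 2.-Sylow(G) P) (abP : abelian P) (nP : P <| G) :
  fully_realizable G <->
    (exists (W : {group 'Z_4}) (hT : finGroupType) (H : {group hT})
            (to : groupAction [set: 'Z_3] H),
        2.-abelem H /\ G \isog setX W [set: sdprod_by to])
    \/
    (exists (W : {group 'Z_4}) (hT : finGroupType) (H : {group hT}),
        2.-abelem H /\ G \isog setX W H).
Proof.
split; first exact: full_necessity sylP abP nP.
case=> [[W [hT [H [to [abelH isoG]]]]] | [W [hT [H [abelH isoG]]]]].
  exact: sdprod_by_realizable sylP abP nP abelH isoG.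
apply: setX_sdprod_realizable sylP abP nP isoG (sdprodg1 H) abelH _.
by left; rewrite cards1.
Qed.
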